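(* There exists a bounded connected open subset $X$ of $\mathbb{R}^2$ with smooth boundary $\partial X$ (equipped with the flat metric of $\mathbb{R}^2$) such that for all sufficiently small $\varepsilon,v>0$ (i.e. there exist $\varepsilon_0,v_0>0$ such that for all $0<\varepsilon<\varepsilon_0$ and $0<v<v_0$) the following holds: for any $T>0$ and any absolutely continuous path $x:[0,T]\to X$ with $\|\dot x\|_\infty\le v$, the moving domain $\omega(t)=B(x(t),\varepsilon)\cap X$ does not satisfy the $t$-GCC in time $T$.
   Context: Generalized geodesics of $X$: the projections onto $\overline X$, parametrized by time $t\in\mathbb{R}$ and traveled at speed $1$, of the generalized bicharacteristics of Melrose and Sjöstrand; they are straight lines traveled at speed $1$ inside $X$ and reflect on $\partial X$ according to the laws of geometric optics. $B(x,\varepsilon)$ is the open Euclidean ball of center $x$ and radius $\varepsilon$, and $\|\dot x\|_\infty$ is the essential supremum over $[0,T]$ of the Euclidean norm of $\dot x(t)$. $t$-GCC (time-dependent geometric control condition): the moving domain $\omega(t)$ satisfies the $t$-GCC in time $T$ if for every generalized geodesic $y$ of $X$ there exists $t\in(0,T)$ such that $y(t)\in\omega(t)$. *)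

(* Defs.v *)
(* The plane is R * R for R : realType.  The library norm on
   products is the max norm (same topology); Euclidean lengths use [enorm]. *)
From mathcomp Require Import all_boot all_order all_algebra.
From mathcomp Require Import all_classical all_reals all_analysis.
From mathcomp Require Import ess_sup_inf.

Set Implicit Arguments.
Unset Strict Implicit.
Unset Printing Implicit Defensive.

Import Order.TTheory GRing.Theory Num.Theory.
Import numFieldNormedType.Exports.

Local Open Scope classical_set_scope.
Local Open Scope ring_scope.

Section Plane.
Context {R : realType}.
Implicit Types (X U : set (R * R)) (q : R * R) (phi : R * R -> R).

Definition enorm q : R := Num.sqrt (q.1 ^+ 2 + q.2 ^+ 2).

Definition eball q (eps : R) : set (R * R) := [set z | enorm (z - q) < eps].

(* C^oo on the open set U: every iterated directional derivative of phi is
   Frechet differentiable (hence continuous) on U. *)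
Definition smooth_on U phi : Prop :=
  forall (vs : seq (R * R)) z, U z ->
    differentiable (foldr (fun v g => 'D_v g) phi vs) z.

(* phi is a local equation of X at its boundary point q, positive in X. *)
Definition boundary_equation X q phi : Prop :=
  exists U, [/\ open U, U q, smooth_on U phi,
    forall z, U z -> (X z <-> 0 < phi z)
    & phi q = 0 /\ exists v, 'D_v phi q != 0].

Definition smooth_boundary X : Prop :=
  forall q, (closure X `\` X°) q -> exists phi, boundary_equation X q phi.

(* A domain is nonempty, as usual. *)
Definition smooth_bounded_domain X : Prop :=
  [/\ X !=set0, open X, connected X, bounded_set X & smooth_boundary X].

End Plane.

(* Generalized bicharacteristics of the wave operator on R x X, in the sense of
   Melrose and Sjostrand, following Hormander, The Analysis of Linear Partial
   Differential Operators III, Section 24.3. *)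
Section Bicharacteristics.
Context {R : realType}.

(* A point of the cotangent bundle T*(R x R^2) is rho = ((t, x), (tau, xi)). *)
Local Notation spacetime := (R * (R * R))%type.
Local Notation phase := ((R * (R * R)) * (R * (R * R)))%type.

Implicit Types (f g : phase -> R) (rho : phase) (gamma : R -> phase).
Implicit Types (X : set (R * R)) (phi : R * R -> R).

Definition grad (h : spacetime -> R) (z : spacetime) : spacetime :=
  ('D_((1, (0, 0)) : spacetime) h z,
   ('D_((0, (1, 0)) : spacetime) h z,
    'D_((0, (0, 1)) : spacetime) h z)).

(* Hamiltonian vector field H_f = (d_zeta f, - d_z f) at rho = (z, zeta). *)
Definition ham f rho : phase :=
  (grad (fun zeta => f (rho.1, zeta)) rho.2,
   - grad (fun z => f (z, rho.2)) rho.1).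

(* Poisson bracket {f, g} = H_f g. *)
Definition bracket f g rho : R := 'D_(ham f rho) g rho.

(* Principal symbol |xi|^2 - tau^2 of the wave operator. *)
Definition wave_symbol rho : R :=
  rho.2.2.1 ^+ 2 + rho.2.2.2 ^+ 2 - rho.2.1 ^+ 2.

Definition lift_phase phi : phase -> R := fun rho => phi rho.1.2.

(* H_p^G = H_p + (H_p^2 phi / H_phi^2 p) H_phi, tangent to the glancing set. *)
Definition gliding_field phi rho : phase :=
  let p := wave_symbol in let F := lift_phase phi in
  ham p rho + (bracket p (bracket p F) rho / bracket F (bracket F p) rho)
              *: ham F rho.

(* Derivative of gamma at s, gamma being only considered on S. *)
Definition derivative_within (S : set R) gamma (s : R) (w : phase) : Prop :=
  (fun h => h^-1 *: (gamma (s + h) - gamma s))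
    @ within [set h | S (s + h)] 0^' --> w.

Definition interior_motion X (B : set R) gamma (s : R) : Prop :=
  X (gamma s).1.2 /\
  derivative_within (~` B) gamma s (ham wave_symbol (gamma s)).

(* gamma s is a glancing point: H_p phi = 0 over a boundary point.  Since
   X = {phi > 0}, it is diffractive iff H_p^2 phi > 0.  None of this, nor the
   value of [gliding_field], depends on the choice of phi. *)
Definition glancing_motion X (B : set R) gamma (s : R) : Prop :=
  let p := wave_symbol in
  exists phi, let F := lift_phase phi in
    [/\ boundary_equation X (gamma s).1.2 phi,
        bracket p F (gamma s) = 0
      & derivative_within (~` B) gamma s
          (if 0 < bracket p (bracket p F) (gamma s) then ham p (gamma s)
           else gliding_field phi (gamma s))].

(* s is an isolated point of B, gamma is over the interior around s, and the
   one-sided limits at s are distinct points, over the same boundary point, of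
   the same fibre of T*(R x R^2)|_(R x bd X) -> T*(R x bd X): they differ by a
   multiple of the conormal d phi, i.e. of H_phi = (0, - d phi). *)
Definition reflection X (B : set R) gamma (s : R) : Prop :=
  (\forall u \near s^', ~ B u /\ X (gamma u).1.2) /\
  exists (rhom rhop : phase) phi (c : R),
    [/\ gamma u @[u --> s^'-] --> rhom,
        gamma u @[u --> s^'+] --> rhop,
        rhom <> rhop,
        boundary_equation X rhom.1.2 phi
      & rhop = rhom + c *: ham (lift_phase phi) rhom].

(* gamma is a map on R \ B; its values on B are irrelevant. *)
Definition generalized_bicharacteristic X (B : set R) gamma : Prop :=
  (forall s, ~ B s ->
     [/\ wave_symbol (gamma s) = 0,
         (gamma s).2 <> (0, (0, 0))
       & interior_motion X B gamma s \/ glancing_motion X B gamma s]) /\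
  (forall s, B s -> reflection X B gamma s).

(* Along gamma, tau is a nonzero constant, dt/ds = - 2 tau and |dx/ds| = 2 |tau|,
   so that the x-projection reparametrized by t is traveled at speed 1;
   continuity determines y at the reflection times. *)
Definition generalized_geodesic X (y : R -> R * R) : Prop :=
  continuous y /\
  exists (B : set R) gamma, generalized_bicharacteristic X B gamma /\
    forall s, ~ B s -> y (gamma s).1.1 = (gamma s).1.2.

Definition tGCC X (omega : R -> set (R * R)) (T : R) : Prop :=
  forall y, generalized_geodesic X y ->
    exists t, 0 < t < T /\ omega t (y t).

End Bicharacteristics.

Section Paths.
Context {R : realType}.
Implicit Types x : R -> R * R.

Definition absolutely_continuous (a b : R) x : Prop :=
  forall e : R, 0 < e -> exists d : R, 0 < d /\
    forall (n : nat) (u w : 'I_n -> R),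
      (forall i, a <= u i /\ u i <= w i /\ w i <= b) ->
      trivIset [set: 'I_n] (fun i => [set t : R | u i < t < w i]) ->
      \sum_i (w i - u i) < d ->
      \sum_i enorm (x (w i) - x (u i)) < e.

(* The value +oo where x has no derivative avoids the default value of the total
   derivative; these points are negligible when x is absolutely continuous. *)
Definition speed x (t : R) : \bar R :=
  if `[< derivable x t 1 >] then (enorm ('D_1 x t))%:E else +oo%E.

Definition speed_sup (T : R) x : \bar R :=
  ess_sup (mrestr lebesgue_measure (measurable_itv `[0, T])) (speed x).

End Paths.

(* Main.v *)
(* Remove from a large disc three unit discs centered at the vertices of a
   triangle.  Billiard rays can be steered there: the shortest closed polygon
   with vertices in a prescribed cyclic sequence of discs (consecutive ones
   distinct) is a billiard orbit, because no disc meets the convex hull of the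
   two others.

   The observer is avoided by choosing the sequence step by step.  Up to a bounded
   error, the time at which the ray reaches its k-th disc is the infimal length of
   the open polygons visiting the first k discs, since replacing the beginning of
   a shortest closed polygon only affects two junctions.  So this time is known
   before the (k+1)-st disc is chosen.  One barycentric coordinate is large at the
   position of the slow observer at that time and remains fairly large until the
   ray hits the next disc; letting the ray travel along the side of the triangle
   opposite to the corresponding vertex keeps it away from the observer.

   An absolutely continuous path with speed at most v almost everywhere is
   v-Lipschitz: cover the exceptional null set by an open set of small measure
   and climb along [a, b] by real induction. *)
Require Import Defs.
From mathcomp Require Import all_boot all_order all_algebra.
From mathcomp Require Import all_classical all_reals all_analysis.
From mathcomp Require Import ess_sup_inf measurable_realfun ring lra zify.

Set Implicit Arguments.
Unset Strict Implicit.
Unset Printing Implicit Defensive.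

Import Order.TTheory GRing.Theory Num.Theory.
Import numFieldNormedType.Exports.

Local Open Scope classical_set_scope.
Local Open Scope ring_scope.

(** * Plane geometry *)

Section Euclid.
Context {R : realType}.
Implicit Types (u v w p q : R * R).

Definition dot u v : R := u.1 * v.1 + u.2 * v.2.

Lemma enorm_ge0 u : 0 <= enorm u.
Proof. exact: sqrtr_ge0. Qed.

Lemma sqr_enorm u : enorm u ^+ 2 = dot u u.
Proof. by rewrite sqr_sqrtr ?addr_ge0 ?sqr_ge0 // /dot !expr2. Qed.

Lemma enorm0 : enorm (0 : R * R) = 0.
Proof. by rewrite /enorm /= expr0n /= addr0 sqrtr0. Qed.

Lemma enormN u : enorm (- u) = enorm u.
Proof. by rewrite /enorm /= !sqrrN. Qed.

Lemma enormB u v : enorm (u - v) = enorm (v - u).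
Proof. by rewrite -enormN opprB. Qed.

Lemma enormZ (a : R) u : enorm (a *: u) = `|a| * enorm u.
Proof.
by rewrite /enorm /= !exprMn -mulrDr sqrtrM ?sqr_ge0 // sqrtr_sqr.
Qed.

Lemma enorm_gt0 u : (0 < enorm u) = (u != 0).
Proof.
have h : (enorm u == 0) = (u == 0).
  rewrite -sqrf_eq0 sqr_enorm /dot -!expr2 paddr_eq0 ?sqr_ge0 // !sqrf_eq0.
  by case: u.
by rewrite lt_neqAle enorm_ge0 andbT eq_sym h.
Qed.

Lemma dot_le u v : dot u v <= enorm u * enorm v.
Proof.
have : dot u v ^+ 2 <= (enorm u * enorm v) ^+ 2.
  rewrite exprMn !sqr_enorm /dot; have := sqr_ge0 (u.1 * v.2 - u.2 * v.1); nra.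
have h0 : 0 <= enorm u * enorm v by rewrite mulr_ge0 ?enorm_ge0.
have [|d0] := lerP (dot u v) 0; first by move=> h _; apply: le_trans h h0.
by rewrite ler_pXn2r // nnegrE // ltW.
Qed.

Lemma enormD u v : enorm (u + v) <= enorm u + enorm v.
Proof.
rewrite -(@ler_pXn2r _ 2) ?nnegrE ?addr_ge0 ?enorm_ge0 //.
have := dot_le u v; rewrite sqrrD !sqr_enorm /dot /=; nra.
Qed.

Lemma enorm_triangle v u w : enorm (u - w) <= enorm (u - v) + enorm (v - w).
Proof. by have := enormD (u - v) (v - w); rewrite addrA subrK. Qed.

Lemma normr1_le_enorm u : `|u.1| <= enorm u.
Proof. by rewrite -sqrtr_sqr ler_wsqrtr // lerDl sqr_ge0. Qed.

Lemma normr2_le_enorm u : `|u.2| <= enorm u.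
Proof. by rewrite -sqrtr_sqr ler_wsqrtr // lerDr sqr_ge0. Qed.

Lemma norm_le_enorm u : `|u| <= enorm u.
Proof. by rewrite prod_normE ge_max normr1_le_enorm normr2_le_enorm. Qed.

Lemma enorm_le_norm u : enorm u <= 2 * `|u|.
Proof.
have h1 : `|u.1| <= `|u| by rewrite prod_normE le_max lexx.
have h2 : `|u.2| <= `|u| by rewrite prod_normE le_max lexx orbT.
rewrite -(@ler_pXn2r _ 2) ?nnegrE ?enorm_ge0 ?mulr_ge0 //.
rewrite sqr_enorm /dot -!expr2 -(real_normK (num_real u.1)).
rewrite -(real_normK (num_real u.2)).
have := normr_ge0 u.1; have := normr_ge0 u.2; nra.
Qed.

Lemma enorm_continuous : continuous (@enorm R).
Proof.
move=> u; apply: (@continuous_comp _ _ _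
  (fun u => u.1 ^+ 2 + u.2 ^+ 2) (@Num.sqrt R)); last exact: sqrt_continuous.
by apply: continuousD; apply: (@continuous_comp _ _ _ _ (fun x : R => x ^+ 2));
  rewrite /continuous_at; [exact: cvg_fst|exact: exprn_continuous|exact: cvg_snd|exact: exprn_continuous].
Qed.

Definition unitv u := (enorm u)^-1 *: u.

Lemma unitvE u : u != 0 -> u = enorm u *: unitv u.
Proof.
by rewrite -enorm_gt0 => h; rewrite /unitv scalerA mulfV ?scale1r ?gt_eqF.
Qed.

Lemma enorm_unitv u : u != 0 -> enorm (unitv u) = 1.
Proof.
rewrite -enorm_gt0 => h; rewrite enormZ gtr0_norm ?invr_gt0 //.
by rewrite mulVf ?gt_eqF.
Qed.

Lemma unitvN u : unitv (- u) = - unitv u.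
Proof. by rewrite /unitv enormN scalerN. Qed.

(* sqrt (A^2 + h) <= A + h / (2 A) *)
Lemma enormD_le u w : u != 0 ->
  enorm (u + w) <= enorm u + dot (unitv u) w + (2 * enorm u)^-1 * enorm w ^+ 2.
Proof.
move=> u0; have A0 : 0 < enorm u by rewrite enorm_gt0.
have e : enorm (u + w) ^+ 2 =
    enorm u ^+ 2 + 2 * enorm u * dot (unitv u) w + enorm w ^+ 2.
  have hd : enorm u * dot (unitv u) w = dot u w.
    by rewrite /unitv /dot /= mulrDr !mulrA mulfV ?gt_eqF // !mul1r.
  rewrite -mulrA hd !sqr_enorm /dot /=; ring.
have := sqr_ge0 (enorm (u + w) - enorm u); rewrite sqrrB e.
set d := dot _ w; set k := (2 * enorm u)^-1.
have k0 : 2 * enorm u * k = 1 by rewrite /k mulfV // gt_eqF // mulr_gt0.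
have kp : 0 < k by rewrite /k invr_gt0 mulr_gt0.
move=> h; rewrite -(@ler_pM2l _ (2 * enorm u)) ?mulr_gt0 //.
rewrite 2!mulrDr mulrA k0; lra.
Qed.

End Euclid.

(** * Optimal reflection points on a unit disc *)

Section Reflection.
Context {R : realType}.
Implicit Types (a b c p q u v w : R * R).

Lemma dotC u v : dot u v = dot v u.
Proof. by rewrite /dot (mulrC u.1) (mulrC u.2). Qed.

Lemma dotDr u v w : dot w (u + v) = dot w u + dot w v.
Proof. by rewrite /dot /=; ring. Qed.

Lemma dotBr u v w : dot w (u - v) = dot w u - dot w v.
Proof. by rewrite /dot /=; ring. Qed.

Lemma dotZl (s : R) u v : dot (s *: u) v = s * dot u v.
Proof. by rewrite /dot /= -!mulrA -mulrDr. Qed.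

Lemma dotZr (s : R) u v : dot u (s *: v) = s * dot u v.
Proof. by rewrite dotC dotZl dotC. Qed.

Lemma enormD_sqr u v : enorm (u + v) ^+ 2 = enorm u ^+ 2 + 2 * dot u v + enorm v ^+ 2.
Proof. by rewrite !sqr_enorm /dot /=; ring. Qed.

(** This extracts first-order conditions: a variation of size [s], divided by [s], leaves a
    remainder [s * C]. *)
Lemma le0_of_le_scaled (x C : R) :
  (forall s : R, 0 < s <= 1 -> x <= s * C) -> x <= 0.
Proof.
move=> h; have [//|x0] := lerP x 0.
have C0 : 0 < C by have := h 1; rewrite ltr01 lexx mul1r => /(_ isT); lra.
have : 0 < x / (x + C) <= 1.
  by rewrite divr_gt0 ?addr_gt0 //= ler_pdivrMr ?addr_gt0 // mul1r lerDl ltW.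
move=> /[dup] /h; set s := x / _ => hs /andP[s0 s1].
have e : s * (x + C) = x by rewrite /s mulrVK // unitfE gt_eqF ?addr_gt0.
have : 0 < s * x by rewrite mulr_gt0.
move: hs; rewrite -[in X in X -> _]e mulrDr; lra.
Qed.

(* First-order condition: the sum of distances to [a] and [b] has gradient [-G]
   at [p], so [G] lies in the normal cone of the disc at [p]. *)
Lemma disc_minimizer c p a b :
  let G := unitv (a - p) + unitv (b - p) in
  enorm (p - c) <= 1 -> a != p -> b != p -> G != 0 ->
  (forall q, enorm (q - c) <= 1 ->
     enorm (a - p) + enorm (b - p) <= enorm (a - q) + enorm (b - q)) ->
  p - c = unitv G.
Proof.
move=> G pD ap bp G0 pmin.
have ap0 : a - p != 0 by rewrite subr_eq0.
have bp0 : b - p != 0 by rewrite subr_eq0.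
(* The disc is convex, so [p] can be moved towards [q] by a fraction [s]; [k] collects the
   second-order coefficients of [enormD_le]. *)
have step q : enorm (q - c) <= 1 -> dot G (q - p) <= 0.
  move=> qD; pose k := ((2 * enorm (a - p))^-1 + (2 * enorm (b - p))^-1).
  apply: (@le0_of_le_scaled _ (k * enorm (p - q) ^+ 2)) => s /andP[s0 s1].
  have /pmin : enorm (p + s *: (q - p) - c) <= 1.
    have -> : p + s *: (q - p) - c = (1 - s) *: (p - c) + s *: (q - c).
      by apply/pair_eqP; rewrite /pair_eq /=; apply/andP; split; apply/eqP;
         rewrite /GRing.scale /=; ring.
    apply: le_trans (enormD _ _) _; rewrite !enormZ (gtr0_norm s0) ger0_norm ?subr_ge0 //.
    nra.
  have e d : d - (p + s *: (q - p)) = (d - p) + s *: (p - q).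
    by rewrite opprD -scalerN opprB addrA.
  rewrite !e; have := enormD_le (s *: (p - q)) ap0; have := enormD_le (s *: (p - q)) bp0.
  have -> : dot G (q - p) = - (dot (unitv (a - p)) (p - q) + dot (unitv (b - p)) (p - q)).
    by rewrite /G /dot /=; ring.
  rewrite !enormZ !dotZr (gtr0_norm s0) /k !exprMn => h1 h2 h3.
  rewrite -(ler_pM2l s0); nra.
(* Testing with the point of the disc farthest in the direction [G] gives
   [1 <= dot (unitv G) (p - c)]; as [enorm (p - c) <= 1], this is the equality case of
   Cauchy-Schwarz. *)
have := step (c + unitv G); rewrite (addrC c) addrK enorm_unitv // => /(_ (lexx _)).
rewrite -addrA -opprB dotBr => h.
have G0' : 0 < enorm G by rewrite enorm_gt0.
have hG : dot G (unitv G) = enorm G.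
  by rewrite dotZr -sqr_enorm expr2 mulrA mulVf ?mul1r // gt_eqF.
have h1 : 1 <= dot (unitv G) (p - c).
  rewrite dotZl -(ler_pM2l G0') mulr1 mulrA mulfV ?gt_eqF // mul1r.
  by move: h; rewrite hG subr_le0.
apply/eqP; rewrite -subr_eq0; have [//|h2] := boolP (_ == 0).
have : 0 < enorm (p - c - unitv G) ^+ 2 by rewrite exprn_gt0 ?enorm_gt0.
have -> u v : enorm (u - v) ^+ 2 = enorm u ^+ 2 - 2 * dot v u + enorm v ^+ 2.
  by rewrite !sqr_enorm /dot /=; ring.
rewrite enorm_unitv // expr1n.
have : enorm (p - c) ^+ 2 <= 1 by rewrite expr_le1 ?enorm_ge0.
lra.
Qed.

(** For unit vectors e and f, the product of e with e + f is 1 + e.f, which is half the squared norm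
    of e + f. Hence both rays leave the disc transversally. *)
Lemma disc_reflection c p a b :
  let G := unitv (a - p) + unitv (b - p) in
  a != p -> b != p -> p - c = unitv G -> G != 0 ->
  0 < dot (unitv (a - p)) (p - c) /\ 0 < dot (unitv (b - p)) (p - c).
Proof.
move=> G ap bp -> G0.
have G0' : 0 < (enorm G)^-1 by rewrite invr_gt0 enorm_gt0.
have ap1 : enorm (unitv (a - p)) = 1 by rewrite enorm_unitv // subr_eq0.
have bp1 : enorm (unitv (b - p)) = 1 by rewrite enorm_unitv // subr_eq0.
rewrite !dotZr !pmulr_rgt0 //.
have : 0 < enorm G ^+ 2 by rewrite exprn_gt0 ?enorm_gt0.
rewrite /G enormD_sqr ap1 bp1 expr1n.
rewrite !dotDr -!sqr_enorm ap1 bp1.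
rewrite (dotC (unitv (b - p)) (unitv (a - p))); lra.
Qed.

Lemma ray_outside c p u (s : R) : enorm (p - c) = 1 -> 0 < dot u (p - c) -> 0 < s ->
  1 < enorm (p + s *: u - c).
Proof.
move=> pc up s0; rewrite -(@ltr_pXn2r _ 2) ?nnegrE ?enorm_ge0 // expr1n.
rewrite addrAC enormD_sqr pc expr1n dotZr dotC.
have : 0 < s * dot u (p - c) by rewrite mulr_gt0.
have := sqr_ge0 (enorm (s *: u)); lra.
Qed.

End Reflection.

(** * Slow observers *)

Section Speed.
Context {R : realType}.
Implicit Types (x : R -> R * R) (O : set R) (l : seq (R * R)).
Local Notation mu := (@lebesgue_measure R).

Lemma derivable_local_speed x (t v e : R) : derivable x t 1 ->
  enorm ('D_1 x t) <= v -> 0 < e ->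
  exists2 h, 0 < h &
    forall s, `|s - t| < h -> enorm (x s - x t) <= (v + e) * `|s - t|.
Proof.
move=> dx dv e0.
(* The limit is taken in the max norm, and [enorm_le_norm] costs a factor 2. *)
have /cvgrPdist_le /(_ (e / 2)) : (fun h => h^-1 *: (x (h *: 1 + t) - x t)) @ 0^' --> 'D_1 x t.
  exact: dx.
rewrite divr_gt0 // => /(_ isT) /nbhs_ballP[h /= h0 hh].
exists h => // s st; have [->|nst] := eqVneq s t.
  by rewrite !subrr enorm0 normr0 mulr0.
have st0 : s - t != 0 by rewrite subr_eq0.
have := hh (s - t); rewrite /ball /= sub0r normrN => /(_ st st0).
rewrite [in X in x X]/GRing.scale /= mulr1 subrK => hd.
have -> : x s - x t = (s - t) *: ('D_1 x t - ('D_1 x t - (s - t)^-1 *: (x s - x t))).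
  by rewrite subKr scalerA mulfV // scale1r.
rewrite enormZ mulrC ler_wpM2r //; apply: le_trans (enormD _ _) _.
rewrite enormN lerD //; apply: le_trans (enorm_le_norm _) _; lra.
Qed.

(* Consecutive intervals of [O] from right to left, ending before [c]. *)
Fixpoint chain O (a c : R) l : Prop :=
  if l is p :: l' then
    [/\ a <= p.1 <= p.2, p.2 <= c, [set z | p.1 < z < p.2] `<=` O & chain O a p.1 l']
  else True.

Lemma chain_nth O a c l (i : nat) : chain O a c l -> (i < size l)%N ->
  let p := nth (0, 0) l i in
  [/\ a <= p.1 <= p.2, p.2 <= c &
      forall j : nat, (i < j < size l)%N -> (nth (0, 0) l j).2 <= p.1].
Proof.
elim: l c i => [//|p l IH] c [|i] /= [ap pc pO hl] il.
  split=> // -[//|j] /= jl; have [] := IH _ j hl; first by rewrite ltnS in jl.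
  by [].
have [h1 h2 h3] := IH _ i hl il; split=> //.
  apply: le_trans h2 _; apply: le_trans pc; by case/andP: ap.
by move=> [//|j]; rewrite /= !ltnS; apply: h3.
Qed.

(** Cutting [O] at [c] makes the induction work: the rightmost interval is disjoint from the part of
    [O] to its left, which carries the other intervals. *)
Lemma chain_measure O a c l : open O -> chain O a c l ->
  ((\sum_(p <- l) (p.2 - p.1))%:E <= mu (O `&` `]-oo, c[))%E.
Proof.
move=> oO; have mO : measurable O by exact: open_measurable.
elim: l c => [|p l IH] c; first by rewrite big_nil measure_ge0.
move=> /= [/andP[_ p12] pc pO hl]; rewrite big_cons addrC EFinD.
have mI : measurable (O `&` `]-oo, p.1[) by apply: measurableI.
apply: (@le_trans _ _ (mu (O `&` `]-oo, p.1[) + mu `]p.1, p.2[)%E).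
  apply: leeD; first exact: IH.
  rewrite lebesgue_measure_itv /= lte_fin.
  by case: ltrP => // h; rewrite lee_fin subr_le0.
rewrite -measureU //; last first.
  rewrite -subset0 => z [[_]] /=; rewrite !in_itv /= => h1 /andP[h2 _].
  by move: (lt_trans h1 h2); rewrite ltxx.
apply: le_measure; rewrite ?inE; [exact: measurableU|exact: measurableI|].
move=> z [[Oz]|] /=; rewrite !in_itv /=.
  by move=> h; split => //; apply: lt_le_trans h (le_trans p12 pc).
move=> /andP[h1 h2]; split; last by rewrite (lt_le_trans h2 pc).
by apply: pO; rewrite /= h1.
Qed.

Lemma absolutely_continuous_chain (T : R) x e : absolutely_continuous 0 T x ->
  0 < e -> exists2 d : R, 0 < d & forall O l, open O -> (mu O < d%:E)%E ->
    chain O 0 T l -> \sum_(p <- l) enorm (x p.2 - x p.1) < e.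
Proof.
move=> ac e0; have [d [d0 hd]] := ac e e0; exists d => // O l oO Od hl.
have := hd (size l) (fun i => (nth (0, 0) l i).1) (fun i => (nth (0, 0) l i).2).
rewrite (big_nth (0, 0)) big_mkord; apply.
- move=> i; have [/andP[h1 h2] h3 _] := chain_nth hl (ltn_ord i).
  by [].
- move=> i j _ _ [z [/= /andP[h1 h2] /andP[h3 h4]]]; apply/val_inj => /=.
  case: (ltngtP i j) => // ij; last first.
    have [_ _ /(_ i)] := chain_nth hl (ltn_ord j); rewrite ij /= ltn_ord => /(_ isT).
    by rewrite leNgt (lt_trans h3 h2).
  have [_ _ /(_ j)] := chain_nth hl (ltn_ord i); rewrite ij /= ltn_ord => /(_ isT).
  by rewrite leNgt (lt_trans h1 h4).
- rewrite -lte_fin; apply: le_lt_trans Od.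
  have := chain_measure oO hl; rewrite (big_nth (0, 0)) big_mkord => /le_trans; apply.
  have mO : measurable O by exact: open_measurable.
  by apply: le_measure; rewrite ?inE //; apply: measurableI.
Qed.

(** Real induction: at the supremum of the points of [[a, b]] satisfying [P], the local hypothesis
    steps across it, which is absurd unless [b] is reached. *)
Lemma interval_induction (a b : R) (P : R -> Prop) : a <= b -> P a ->
  (forall t, a <= t <= b -> exists2 h, 0 < h &
     forall c c', a <= c -> c' <= b -> t - h < c -> c <= t -> t <= c' -> c' < t + h ->
       P c -> P c') ->
  P b.
Proof.
move=> ab Pa hP; pose C := [set c | a <= c <= b /\ P c].
have Ca : C a by rewrite /C /= lexx ab.
have hC : has_sup C by split; [exists a|exists b => c [/andP[]]].
pose s := sup C.
have as_ : a <= s by apply: ub_le_sup => //; case: hC.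
have sb : s <= b by apply: ge_sup; [exists a|move=> c [/andP[]]].
have [|h h0 hh] := hP s; first by rewrite as_ sb.
have [c [/andP[ac cb] Pc] sc] := sup_adherent h0 hC.
have cs : c <= s by apply: ub_le_sup; [case: hC|split => //; rewrite ac].
have [bs|sb'] := lerP b (s + h / 2).
  apply: (hh c b) => //; apply: le_lt_trans bs _; lra.
have : C (s + h / 2).
  split; first by apply/andP; split; lra.
  by apply: (hh c) => //; try lra.
by move=> /(ub_le_sup (proj2 hC)); rewrite -/s; lra.
Qed.

(** Since [speed] is +oo where [x] is not derivable, the essential bound also yields derivability
    almost everywhere. The null set of the restricted measure is intersected with [[0, T]]. *)
Lemma ae_speed (T v : R) x : (speed_sup T x <= v%:E)%E ->
  exists N : set R, [/\ measurable N, mu N = 0 &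
    forall t : R, 0 <= t <= T -> ~ N t -> derivable x t 1 /\ enorm ('D_1 x t) <= v].
Proof.
move=> /ess_supP[N [mN N0 hN]]; exists (N `&` `[0, T]).
split=> //; first exact: measurableI.
move=> t tT nN; have : (speed x t <= v%:E)%E.
  by apply: contrapT => h; apply: nN; split; [exact: hN|rewrite /= in_itv].
rewrite /speed; case: ifP => [/asboolP dx|_]; last by rewrite leye_eq.
by rewrite lee_fin.
Qed.

Lemma slow_path (T v : R) x : 0 <= v -> absolutely_continuous 0 T x ->
  (speed_sup T x <= v%:E)%E ->
  forall a b : R, 0 <= a -> a <= b -> b <= T -> enorm (x b - x a) <= v * (b - a).
Proof.
move=> v0 ac /ae_speed[N [mN N0 hN]] a b a0 ab bT.
(* The slack is [e * (b - a)] from the points of derivability plus [e] from the chain covering the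
   null set. *)
suff h (e : R) : 0 < e -> enorm (x b - x a) <= v * (b - a) + e * (b - a + 1).
  apply/ler_addgt0Pr => e e0; have k0 : 0 < b - a + 1 by lra.
  have := h (e / (b - a + 1)); rewrite divr_gt0 // => /(_ isT).
  by rewrite mulrVK // unitfE gt_eqF.
move=> e0; have [d d0 hd] := absolutely_continuous_chain ac e0.
have [|O [oO NO hO]] := lebesgue_regularity_outer mN _ d0.
  by rewrite [X in (X < _)%E]N0.
have Od : (mu O < d%:E)%E.
  have mO : measurable O by exact: open_measurable.
  have -> : O = (O `\` N) `|` N by rewrite setUC setDUK.
  rewrite measureU //; [|exact: measurableD|].
    by rewrite [X in (_ + X)%E]N0 adde0.
  by rewrite -subset0 => z [[]].
suff [l hl hx] : exists2 l, chain O 0 b l &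
    enorm (x b - x a) <= (v + e) * (b - a) + \sum_(p <- l) enorm (x p.2 - x p.1).
  have hl' : chain O 0 T l by case: l hl {hx} => //= p l [? h ? ?]; split => //; apply: le_trans h bT.
  have := hd O l oO Od hl'; nra.
(* Around a point of [O] the chain is extended by the interval [(c, c')]; elsewhere the path is
   derivable with speed at most [v], and [derivable_local_speed] applies on both sides of [t]. *)
apply: (@interval_induction a b (fun c => exists2 l, chain O 0 c l &
    enorm (x c - x a) <= (v + e) * (c - a) + \sum_(p <- l) enorm (x p.2 - x p.1))) => //.
  by exists [::] => //; rewrite !subrr enorm0 mulr0 big_nil addr0.
move=> t /andP[at_ tb]; have [Ot|nOt] := pselect (O t).
  have /nbhs_ballP[h h0 hO'] := open_nbhs_nbhs (conj oO Ot).
  exists h => // c c' ac' c'b tc ct tc' c't [l hl hx].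
  exists ((c, c') :: l) => /=.
    split=> //; [by rewrite (le_trans a0 ac') (le_trans ct tc')|].
    move=> z /= /andP[h1 h2]; apply: hO'; rewrite /ball /= ltr_norml; lra.
  rewrite big_cons /=; apply: le_trans (enorm_triangle (x c) _ _) _.
  have : (v + e) * (c - a) <= (v + e) * (c' - a).
    by rewrite ler_wpM2l ?addr_ge0 ?(ltW e0) // lerB // (le_trans ct).
  lra.
have [dx dv] : derivable x t 1 /\ enorm ('D_1 x t) <= v.
  by apply: hN => [|/NO//]; rewrite (le_trans a0 at_) (le_trans tb bT).
have [h h0 hh] := derivable_local_speed dx dv e0.
exists h => // c c' ac' c'b tc ct tc' c't [l hl hx]; exists l.
  case: l hl {hx} => //= p l [? h1 ? ?]; split => //; apply: le_trans h1 _.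
  exact: le_trans ct tc'.
apply: le_trans (enorm_triangle (x c) _ _) _.
have h1 : enorm (x c' - x t) <= (v + e) * (c' - t).
  have := hh c'; rewrite ger0_norm ?subr_ge0 //; apply; lra.
have h2 : enorm (x t - x c) <= (v + e) * (t - c).
  have := hh c; rewrite ler0_norm ?subr_le0 // opprB enormB; apply; lra.
have := enorm_triangle (x t) (x c') (x c); nra.
Qed.

End Speed.

(** * The domain *)

Section Quadratic.
Context {R : realType}.
Implicit Types (z v b : R * R).

(** This family contains the equations of all circles and is stable under directional derivatives,
    so smoothness reduces to differentiability of its members. *)
Definition quad (a : R) b (d : R) z : R := a * dot z z + dot b z + d.

Lemma differentiable_quad a b d z : differentiable (quad a b d) z.
Proof.
have d1 : differentiable (fst : R * R -> R) z.
  by apply: linear_differentiable => u; exact: cvg_fst.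
have d2 : differentiable (snd : R * R -> R) z.
  by apply: linear_differentiable => u; exact: cvg_snd.
by rewrite /quad /dot; do ?[apply: differentiableD|apply: differentiableM|
  apply: differentiable_cst|assumption].
Qed.

(** The difference quotient is exactly [l + h * c]. Polynomials of degree at most 2 along lines are
    differentiated this way, both in the plane and in phase space. *)
Lemma derive_quadratic (V : normedModType R) (f : V -> R) (u w : V) (l c : R) :
  (forall h : R, f (h *: w + u) = f u + h * l + h ^+ 2 * c) -> 'D_w f u = l.
Proof.
move=> hf; apply: cvg_lim => //=.
have e : {near 0^', (fun h => l + h * c) =1 (fun h : R => h^-1 *: (f (h *: w + u) - f u))}.
  apply: filterS (nbhs_dnbhs_neq 0) => h h0.
  rewrite hf /GRing.scale /=; field.
  exact: h0.
apply: cvg_trans (near_eq_cvg e) _.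
have : (fun h : R => l + h * c) @ 0^' --> l + 0 * c.
  apply: cvgD; first exact: cvg_cst.
  by apply: cvgM; [exact: nbhs_dnbhs|exact: cvg_cst].
by rewrite mul0r addr0.
Qed.

Lemma derive_quad a b d v : 'D_v (quad a b d) = quad 0 ((2 * a) *: v) (dot b v).
Proof.
apply/funext => z; apply: (@derive_quadratic _ _ _ _ _ (a * dot v v)) => h.
by rewrite /quad /dot /=; rewrite /GRing.scale /=; ring.
Qed.

Lemma derive_quadE a b d v z : 'D_v (quad a b d) z = 2 * a * dot z v + dot b v.
Proof. by rewrite [LHS](congr1 (@^~ z) (derive_quad a b d v)) /quad /dot /= /GRing.scale /=; ring. Qed.

Lemma smooth_quad (U : set (R * R)) a b d : smooth_on U (quad a b d).
Proof.
move=> vs z _; suff [a' [b' [d' ->]]] : exists a' b' d',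
    foldr (fun v g => 'D_v g) (quad a b d) vs = quad a' b' d'.
  exact: differentiable_quad.
elim: vs => [|v vs [a' [b' [d' /= ->]]]]; first by exists a, b, d.
by exists 0, ((2 * a') *: v), (dot b' v); exact: derive_quad.
Qed.

Lemma quad_continuous a b d : continuous (quad a b d).
Proof. by move=> z; apply: differentiable_continuous; exact: differentiable_quad. Qed.

End Quadratic.

Section Connected.
Context {R : realType}.
Implicit Types (A : set (R * R)) (p q z : R * R).

Lemma segment_component A p q :
  (forall s : R, 0 <= s <= 1 -> A (p + s *: (q - p))) -> connected_component A p q.
Proof.
move=> hA; exists ((fun s : R => p + s *: (q - p)) @` `[0, 1]); last first.
  by exists 1; rewrite /= ?in_itv /= ?ler01 ?lexx // scale1r addrC subrK.
split.
- by exists 0; rewrite /= ?in_itv /= ?ler01 ?lexx // scale0r addr0.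
- by move=> _ [s /= + <-]; rewrite in_itv /=; apply: hA.
- apply: connected_continuous_connected; first exact: segment_connected.
  apply: continuous_subspaceT => s; apply: cvgD; first exact: cvg_cst.
  exact: scalel_continuous.
Qed.

End Connected.

(** * The triangle, its three discs and the outer circle of radius 20 *)

Inductive vertex := Va | Vb | Vc.

Section Triangle.
Context {R : realType}.
Implicit Types (i j k : vertex) (p q z : R * R) (s : R).

Definition center k : R * R :=
  match k with Va => (- 8, 0) | Vb => (8, 0) | Vc => (0, 8) end.

(* Barycentric coordinates in the triangle of the centers, of total weight 8. *)
Definition lam k z : R :=
  match k with
  | Va => (8 - z.1 - z.2) / 2
  | Vb => (8 + z.1 - z.2) / 2
  | Vc => z.2
  end.

Definition disc k : set (R * R) := [set z | enorm (z - center k) <= 1].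

Definition circle k : R * R -> R :=
  quad 1 (- 2 *: center k) (dot (center k) (center k) - 1).

Definition outer : R * R -> R := quad (- 1) 0 400.

Definition domain : set (R * R) :=
  [set z | 0 < outer z /\ forall k, 0 < circle k z].

Lemma circleE k z : circle k z = enorm (z - center k) ^+ 2 - 1.
Proof. by rewrite sqr_enorm /circle /quad /dot /= /GRing.scale /=; ring. Qed.

Lemma outerE z : outer z = 400 - enorm z ^+ 2.
Proof. by rewrite sqr_enorm /outer /quad /dot /=; ring. Qed.

Lemma circle_gt0 k z : (0 < circle k z) = (1 < enorm (z - center k)).
Proof. by rewrite circleE subr_gt0 -{1}(expr1n _ 2) ltr_pXn2r ?nnegrE ?enorm_ge0. Qed.

Lemma outer_gt0 z : (0 < outer z) = (enorm z < 20).
Proof.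
rewrite outerE subr_gt0 (_ : 400 = 20 ^+ 2 :> R); last by ring.
by rewrite ltr_pXn2r ?nnegrE ?enorm_ge0.
Qed.

Lemma circle_continuous k : continuous (circle k).
Proof. exact: quad_continuous. Qed.

Lemma outer_continuous : continuous outer.
Proof. exact: quad_continuous. Qed.

Lemma lam_sum z : lam Va z + lam Vb z + lam Vc z = 8.
Proof. by rewrite /lam; field. Qed.

(** The coordinates have gradients of norm at most 1, so a gap in one coordinate separates the ray
    from the observer. *)
Lemma lam_lip k p q : lam k p - lam k q <= enorm (p - q).
Proof.
have := normr1_le_enorm (p - q); have := normr2_le_enorm (p - q).
rewrite !ler_norml /=; case: k => /=; lra.
Qed.

Lemma lam_affine k p q s :
  lam k (p + s *: (q - p)) = (1 - s) * lam k p + s * lam k q.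
Proof. by case: k => /=; rewrite /GRing.scale /=; field. Qed.

(** [lam k] is 8 at its own center and 0 at the two others, and varies by at most 1 from the center
    of a unit disc. *)
Lemma lam_disc k z : disc k z -> 7 <= lam k z.
Proof.
rewrite /disc /= => h; have := lam_lip k (center k) z; rewrite enormB.
by case: k h => /=; lra.
Qed.

Lemma lam_disc_neq k j z : j <> k -> disc j z -> lam k z <= 1.
Proof.
rewrite /disc /= => jk h; have := lam_lip k z (center j).
by case: k j jk h => [] [] //=; lra.
Qed.

Lemma disc_bounded k z : disc k z -> enorm z <= 9.
Proof.
rewrite /disc /= => h; have := enormD (z - center k) (center k); rewrite subrK.
suff : enorm (center k) <= 8 by lra.
rewrite -(@ler_pXn2r _ 2) ?nnegrE ?enorm_ge0 // sqr_enorm /dot.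
by case: k {h} => /=; lra.
Qed.

Lemma enorm_segment p q s : 0 <= s <= 1 ->
  enorm (p + s *: (q - p)) <= (1 - s) * enorm p + s * enorm q.
Proof.
move=> /andP[s0 s1]; have -> : p + s *: (q - p) = (1 - s) *: p + s *: q.
  by rewrite scalerBl scale1r scalerBr addrA addrAC.
by apply: le_trans (enormD _ _) _; rewrite !enormZ !ger0_norm ?subr_ge0.
Qed.

Lemma convex_comb_lt (a b c s : R) : 0 <= s <= 1 -> a < c -> b < c ->
  (1 - s) * a + s * b < c.
Proof.
move=> /andP[s0 s1] ac bc; have [ab|/ltW ba] := lerP a b.
  by apply: le_lt_trans bc; have : (1 - s) * a <= (1 - s) * b; [rewrite ler_wpM2l ?subr_ge0|lra].
by apply: le_lt_trans ac; have : s * b <= s * a; [rewrite ler_wpM2l|lra].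
Qed.

Lemma domain_open : open domain.
Proof.
have op f : continuous (f : R * R -> R) -> open [set z | 0 < f z].
  by move=> cf; apply: (open_comp _ (@open_gt R 0)) => z _; exact: cf.
have -> : domain = [set z | 0 < outer z] `&` ([set z | 0 < circle Va z] `&`
    ([set z | 0 < circle Vb z] `&` [set z | 0 < circle Vc z])).
  apply/seteqP; split => z /=; first by move=> [? h]; split.
  by move=> [? [? [? ?]]]; split => // -[].
by do ?apply: openI; apply: op; exact: quad_continuous.
Qed.

Lemma domain_nonempty : domain (0, 10).
Proof.
split; first by rewrite /outer /quad /dot /=; lra.
by case; rewrite /circle /quad /dot /= /GRing.scale /=; lra.
Qed.

Lemma domain_bounded : bounded_set domain.
Proof.
exists 20; split=> // M M20 z [+ _]; rewrite outer_gt0 => z20.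
by apply: le_trans (norm_le_enorm z) _; apply/ltW/(lt_trans z20).
Qed.

Lemma closure_ge0 (A : set (R * R)) (f : R * R -> R) z : continuous f ->
  A `<=` [set z | 0 < f z] -> closure A z -> 0 <= f z.
Proof.
move=> cf Af Az; have cl : closed (f @^-1` [set x | 0 <= x]).
  by apply: preimage_closed => [? _|]; [exact: cf|exact: closed_ge].
by apply: cl; apply: closure_subset Az => y /Af /= /ltW.
Qed.

Lemma boundary_circle k q : circle k q = 0 -> (forall j, j <> k -> 0 < circle j q) ->
  0 < outer q -> boundary_equation domain q (circle k).
Proof.
move=> qk qj qo; exists [set z | 0 < outer z /\ forall j, j <> k -> 0 < circle j z].
have op f : continuous (f : R * R -> R) -> open [set z | 0 < f z].
  by move=> cf; apply: (open_comp _ (@open_gt R 0)) => z _; exact: cf.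
have opj j : open [set z : R * R | j <> k -> 0 < circle j z].
  have [->|jk] := pselect (j = k).
    rewrite (_ : mkset _ = setT); first exact: openT.
    by rewrite -subTset => z _ jj; case: jj.
  rewrite (_ : mkset _ = [set z | 0 < circle j z]); first exact/op/quad_continuous.
  by apply/seteqP; split => z /= ; [apply|move=> ? _].
split.
- rewrite (_ : mkset _ = [set z | 0 < outer z] `&`
    ([set z | Va <> k -> 0 < circle Va z] `&`
    ([set z | Vb <> k -> 0 < circle Vb z] `&` [set z | Vc <> k -> 0 < circle Vc z]))).
    by apply: openI; [exact/op/quad_continuous|do ?apply: openI].
  apply/seteqP; split => z /=; first by move=> [? h]; split => //; do ?split; apply: h.
  by move=> [? [? [? ?]]]; split => // -[].
- by [].
- exact: smooth_quad.
- move=> z [zo zj]; split => [[_]|zk]; first exact.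
  split=> // j; have [->//|] := pselect (j = k); exact: zj.
(* Along the outer normal of the unit disc the derivative is 2. *)
- split=> //; exists (q - center k); rewrite /circle derive_quadE.
  have : enorm (q - center k) ^+ 2 = 1 by apply/eqP; rewrite -subr_eq0 -circleE qk.
  rewrite sqr_enorm /dot /= /GRing.scale /= => h.
  apply/eqP => h'; lra.
Qed.

Lemma boundary_outer q : outer q = 0 -> (forall j, 0 < circle j q) ->
  boundary_equation domain q outer.
Proof.
move=> qo qj; exists [set z | forall j, 0 < circle j z].
have op f : continuous (f : R * R -> R) -> open [set z | 0 < f z].
  by move=> cf; apply: (open_comp _ (@open_gt R 0)) => z _; exact: cf.
split.
- rewrite (_ : mkset _ = [set z | 0 < circle Va z] `&`
    ([set z | 0 < circle Vb z] `&` [set z | 0 < circle Vc z])).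
    by do ?apply: openI; apply: op; exact: quad_continuous.
  apply/seteqP; split => z /=; first by move=> h; do ?split; apply: h.
  by move=> [? [? ?]] [].
- by [].
- exact: smooth_quad.
- by move=> z zj; split => [[]|].
- split=> //; exists q; rewrite /outer derive_quadE.
  have : enorm q ^+ 2 = 400 by apply/esym/eqP; rewrite -subr_eq0 -outerE qo.
  rewrite sqr_enorm /dot /= /GRing.scale /= => h.
  apply/eqP => h'; lra.
Qed.

Lemma disc_circle_gt0 k j q : disc k q -> j <> k -> 0 < circle j q.
Proof.
move=> qk jk; rewrite circle_gt0 ltNge; apply/negP => qj.
have := lam_disc qj; have := lam_disc_neq (nesym jk) qk; lra.
Qed.

Lemma disc_outer_gt0 k q : disc k q -> 0 < outer q.
Proof. by rewrite outer_gt0 => /disc_bounded; lra. Qed.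

(** At a boundary point all four functions are nonnegative and one vanishes. The three discs are
    disjoint and lie inside the outer circle, so the other functions are positive there. *)
Lemma domain_smooth_boundary : smooth_boundary domain.
Proof.
move=> q [qcl]; rewrite (interior_id domain).1; last exact: domain_open.
move=> nq; have qo : 0 <= outer q.
  by apply: closure_ge0 qcl; [exact: outer_continuous|move=> z []].
have qj j : 0 <= circle j q.
  by apply: closure_ge0 qcl; [exact: circle_continuous|move=> z [_]; exact].
have [[k qk]|h] := pselect (exists k, circle k q = 0).
  exists (circle k).
  have kd : disc k q.
    by rewrite /disc /= leNgt -circle_gt0 qk ltxx.
  apply: boundary_circle => //; last exact: disc_outer_gt0 kd.
  by move=> j; apply: disc_circle_gt0.
have qj' j : 0 < circle j q.
  by rewrite lt_neqAle qj andbT eq_sym; apply/eqP => e; apply: h; exists j.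
exists outer; apply: boundary_outer => //.
apply/eqP; apply: contrapT => /negP qo'; apply: nq; split => //.
by rewrite lt_neqAle eq_sym qo' qo.
Qed.

Lemma cap_domain z : enorm z < 20 -> `|z.1| > 9 \/ `|z.2| > 9 -> domain z.
Proof.
move=> z20 h; split; first by rewrite outer_gt0.
move=> k; rewrite circle_gt0; have := normr1_le_enorm (z - center k).
have := normr2_le_enorm (z - center k).
have h1 i : `|(center i).1| <= 8 by case: i => /=; rewrite ?normrN ?normr0 ?ger0_norm.
have h2 i : `|(center i).2| <= 8 by case: i => /=; rewrite ?normr0 ?ger0_norm.
have := h1 k; have := h2 k; have := lerB_dist z.1 (center k).1; have := lerB_dist z.2 (center k).2.
rewrite /=; lra.
Qed.

(** The square of half-side 9 contains the three discs; each side line cuts off a convex cap of the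
    outer disc, inside which segments stay in the domain. *)
Lemma cap_component p q : enorm p < 20 -> enorm q < 20 ->
  [\/ 9 < p.1 /\ 9 < q.1, p.1 < - 9 /\ q.1 < - 9, 9 < p.2 /\ 9 < q.2
    | p.2 < - 9 /\ q.2 < - 9] ->
  connected_component domain p q.
Proof.
move=> p20 q20 h; apply: segment_component => s /[dup] /(enorm_segment p q).
move=> hs s01; apply: cap_domain; first by apply: le_lt_trans hs _; exact: convex_comb_lt.
have cvx (a b c : R) : a < c -> b < c -> a + s * (b - a) < c.
  by move=> ac bc; have := convex_comb_lt s01 ac bc; lra.
rewrite !ltr_normr /= /GRing.scale /=.
case: h => -[h1 h2]; [left|left|right|right]; apply/orP; [left|right|left|right].
- by have := cvx (- p.1) (- q.1) (- 9); rewrite !ltrN2 => /(_ h1 h2); lra.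
- by have := cvx p.1 q.1 (- 9) h1 h2; lra.
- by have := cvx (- p.2) (- q.2) (- 9); rewrite !ltrN2 => /(_ h1 h2); lra.
- by have := cvx p.2 q.2 (- 9) h1 h2; lra.
Qed.

Lemma enorm_lt20 z : z.1 ^+ 2 + z.2 ^+ 2 < 400 -> enorm z < 20.
Proof.
rewrite -outer_gt0 /outer /quad /dot /=; lra.
Qed.

(* Each vertical line meets at most one disc, so one of its half-lines starting
   at a point of the domain avoids the discs. *)
Lemma box_component z : domain z -> `|z.1| <= 9 -> `|z.2| <= 9 ->
  exists2 y, y = 10 \/ y = - 10 & connected_component domain z (z.1, y).
Proof.
rewrite !ler_norml => -[_ zj] hx hy.
have key (y : R) : (y = 10 \/ y = - 10) -> (forall k, 1 < `|z.1 - (center k).1| \/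
    0 <= (y - z.2) * (z.2 - (center k).2)) -> connected_component domain z (z.1, y).
  move=> y10 hk; apply: segment_component => s /andP[s0 s1].
  have e : z + s *: ((z.1, y) - z) = (z.1, z.2 + s * (y - z.2)).
    by apply/pair_eqP; rewrite /pair_eq /=; apply/andP; split; apply/eqP;
       rewrite /GRing.scale /=; ring.
  rewrite e; split.
    rewrite outer_gt0; apply: enorm_lt20 => /=.
    have w10 : - 10 <= z.2 + s * (y - z.2) <= 10.
      by apply/andP; split; case: y10 => ->; nra.
    have : 0 <= (9 - z.1) * (9 + z.1) by rewrite mulr_ge0; lra.
    have : 0 <= (10 - (z.2 + s * (y - z.2))) * (10 + (z.2 + s * (y - z.2))).
      by rewrite mulr_ge0; lra.
    lra.
  move=> k; have [h|h] := hk k.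
    rewrite circle_gt0; apply: lt_le_trans h _.
    exact: normr1_le_enorm ((z.1, z.2 + s * (y - z.2)) - center k).
  have := zj k; rewrite !circleE !sqr_enorm /dot /=.
  have := sqr_ge0 (s * (y - z.2)); have : 0 <= s * ((y - z.2) * (z.2 - (center k).2)).
    by rewrite mulr_ge0.
  nra.
have [h|h] := pselect (forall k, 1 < `|z.1 - (center k).1| \/
    0 <= (10 - z.2) * (z.2 - (center k).2)).
  by exists 10; [left|apply: key => //; left].
(* A disc [j] that blocks the upward half-line has its center above [z], so the downward one avoids
   it; the abscissas of the other centers are at least 8 away from that of [j]. *)
exists (- 10); [by right|apply: key; [by right|]] => k.
move: h => /existsNP[j /not_orP[/negP h1 /negP h2]].
have [->|kj] := pselect (k = j).
  by right; move: h2; rewrite -ltNge => h2; nra.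
left; move: h1; rewrite -leNgt ler_norml ltr_normr => h1; apply/orP.
case: k j kj h1 {h2} => [] [] //= _; (try by left; lra); (try by right; lra).
Qed.

Lemma domain_connected : connected domain.
Proof.
suff -> : domain = connected_component domain (10, 10) by exact: component_connected.
apply/seteqP; split; last exact: connected_component_sub.
have c20 (a b : R) : (a = 10 \/ a = - 10) -> (b = 10 \/ b = - 10) -> enorm (a, b) < 20.
  by move=> ha hb; apply: enorm_lt20 => /=; case: ha => ->; case: hb => ->; lra.
(* Each corner lies in two adjacent caps, which links the four caps together. *)
have corner (a b : R) : (a = 10 \/ a = - 10) -> (b = 10 \/ b = - 10) ->
    connected_component domain (10, 10) (a, b).
  move=> ha hb; have l : 10 = 10 :> R \/ 10 = - 10 :> R by left.
  apply: (connected_component_trans (y := (10, b) : R * R)); apply: cap_component; rewrite ?c20 //=.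
    by apply: Or41; split; lra.
  by case: hb => ->; [apply: Or43|apply: Or44]; split; lra.
move=> z zX; have z20 : enorm z < 20 by case: zX; rewrite outer_gt0.
have l : 10 = 10 :> R \/ 10 = - 10 :> R by left.
have r : - 10 = 10 :> R \/ - 10 = - 10 :> R by right.
have [h1|h1] := lerP `|z.1| 9; last first.
  move: h1; rewrite ltr_normr => /orP[h1|h1].
    apply: (connected_component_trans (y := (10, 10) : R * R)); first exact: corner.
    by apply: cap_component => //=; rewrite ?c20 //; apply: Or41; split; lra.
  apply: (connected_component_trans (y := (- 10, 10) : R * R)); first exact: corner.
  by apply: cap_component => //=; rewrite ?c20 //; apply: Or42; split; lra.
have [h2|h2] := lerP `|z.2| 9; last first.
  move: h2; rewrite ltr_normr => /orP[h2|h2].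
    apply: (connected_component_trans (y := (10, 10) : R * R)); first exact: corner.
    by apply: cap_component => //=; rewrite ?c20 //; apply: Or43; split; lra.
  apply: (connected_component_trans (y := (10, - 10) : R * R)); first exact: corner.
  by apply: cap_component => //=; rewrite ?c20 //; apply: Or44; split; lra.
have [y hy /connected_component_sym hz] := box_component zX h1 h2.
apply: connected_component_trans hz.
apply: (connected_component_trans (y := (10, y) : R * R)); first exact: corner.
apply: cap_component => /=; first by apply: c20.
  move: h1; rewrite ler_norml => h1.
  have : 0 <= (9 - z.1) * (9 + z.1) by rewrite mulr_ge0; lra.
  by move=> ?; apply: enorm_lt20 => /=; case: hy => ->; lra.
by case: hy => ->; [apply: Or43|apply: Or44]; split; lra.
Qed.

Lemma domain_smooth_bounded : smooth_bounded_domain domain.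
Proof.
split; first by exists (0, 10); exact: domain_nonempty.
- exact: domain_open.
- exact: domain_connected.
- exact: domain_bounded.
- exact: domain_smooth_boundary.
Qed.

End Triangle.

(** * Billiard orbits as generalized geodesics *)

Section Clock.
Context {R : realType}.
Variable ell : int -> R.
Hypothesis ell_ge1 : forall k, 1 <= ell k.

(** Arrival times along a two-sided sequence of edge lengths, with time 0 at index 0. [Negz n]
    stands for -(n + 1), hence the [n.+1] terms. *)
Definition clock (k : int) : R :=
  match k with
  | Posz n => \sum_(i < n) ell i
  | Negz n => - \sum_(i < n.+1) ell (Negz i)
  end.

Lemma clock0 : clock 0 = 0.
Proof. exact: big_ord0. Qed.

Lemma clock_succ k : clock (k + 1) = clock k + ell k.
Proof.
case: k => [n|[|n]].
- by rewrite (_ : Posz n + 1 = Posz n.+1) /= ?big_ord_recr //; lia.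
- by rewrite (_ : Negz 0 + 1 = 0) //= big_ord0 big_ord1 addNr.
- rewrite (_ : Negz n.+1 + 1 = Negz n); last by rewrite !NegzE; lia.
  by rewrite /= [in RHS]big_ord_recr /= opprD subrK.
Qed.

Lemma clock_pred k : clock k = clock (k - 1) + ell (k - 1).
Proof. by rewrite -clock_succ subrK. Qed.

Lemma clock_addn k (n : nat) : clock k + n%:R <= clock (k + n%:Z).
Proof.
elim: n => [|n IH]; first by rewrite !addr0.
rewrite -addn1 PoszD addrA clock_succ natrD addrA.
by rewrite lerD.
Qed.

Lemma clock_le k l : k <= l -> clock k <= clock l.
Proof.
move=> kl; have [n ->] : exists n : nat, l = k + n%:Z.
  by exists `|l - k|%N; lia.
by apply: le_trans (clock_addn k n); rewrite lerDl.
Qed.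

(** Lengths bounded below by 1 keep the arrival times from accumulating, in both directions of
    time. *)
Lemma clock_locate s : exists k, clock k <= s < clock (k + 1).
Proof.
have [m sm] : exists m : nat, `|s| < m%:R.
  by have := archi_boundP (normr_ge0 s); exists (Num.bound `|s|).
have lo : clock (- m%:Z) <= s.
  have := clock_addn (- m%:Z) m; rewrite addNr clock0.
  by move: sm; rewrite ltr_norml; lra.
have hi : exists n : nat, s < clock (- m%:Z + n%:Z).
  exists (m + m)%N; have := clock_addn 0 m; rewrite clock0 !add0r PoszD addKr.
  by move: sm; rewrite ltr_norml; lra.
case: (ex_minnP hi) => -[|n].
  by rewrite addr0 ltNge lo.
move=> hn hmin {hi}; exists (- m%:Z + n%:Z); rewrite -addrA -PoszD addn1 hn andbT.
by rewrite leNgt; apply/negP => /hmin; rewrite ltnn.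
Qed.

Lemma clock_unique k l s : clock k <= s < clock (k + 1) ->
  clock l <= s < clock (l + 1) -> k = l.
Proof.
move=> /andP[k1 k2] /andP[l1 l2]; apply/eqP; rewrite eq_le -!ltzD1 !ltNge.
by apply/andP; split; apply/negP => /clock_le; [move: k1 l2|move: l1 k2]; lra.
Qed.

Definition tick s : int := xget 0 [set k | clock k <= s < clock (k + 1)].

Lemma tickP s : clock (tick s) <= s < clock (tick s + 1).
Proof. exact: xgetPex (clock_locate s). Qed.

Lemma tickE k s : clock k <= s < clock (k + 1) -> tick s = k.
Proof. by move=> h; apply: clock_unique (tickP s) h. Qed.

Lemma clock_not_in_range k s : clock k < s < clock (k + 1) -> ~ range clock s.
Proof.
move=> /andP[h1 h2] [l _ e]; have : k = l.
  apply: (@clock_unique k l s); first by rewrite ltW.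
  by rewrite -e lexx /= clock_succ ltrDl (lt_le_trans ltr01).
by move=> kl; move: h1; rewrite -e kl ltxx.
Qed.

Lemma not_in_range_clock s : ~ range clock s ->
  clock (tick s) < s < clock (tick s + 1).
Proof.
move=> nB; have /andP[h1 h2] := tickP s; rewrite h2 andbT lt_neqAle h1 andbT.
by apply/eqP => e; apply: nB; exists (tick s).
Qed.

End Clock.

Lemma cvg_to_pair {T : Type} {U V : topologicalType} (F : set_system T) {FF : Filter F}
  (f : T -> U) (g : T -> V) (a : U) (b : V) :
  f @ F --> a -> g @ F --> b -> (fun x => (f x, g x)) @ F --> (a, b).
Proof. by move=> fa gb; exact: (cvg_pair (FF := FF) fa gb). Qed.

(** * Hamiltonian fields of the wave symbol and of a boundary equation *)

Section Symbol.
Context {R : realType}.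

Lemma ham_wave_symbol (s tau : R) (z xi : R * R) :
  ham wave_symbol ((s, z), (tau, xi)) = ((- 2 * tau, 2 *: xi), (0, (0, 0))).
Proof.
rewrite /ham /grad /wave_symbol /=; congr (_, _).
  congr (_, _); last (apply/pair_eqP; rewrite /pair_eq /=; apply/andP; split; apply/eqP).
  - apply: (@derive_quadratic _ _ _ _ _ _ (- 1)) => h /=.
    by rewrite /GRing.scale /=; ring.
  - apply: (@derive_quadratic _ _ _ _ _ _ 1) => h /=.
    by rewrite /GRing.scale /=; ring.
  - apply: (@derive_quadratic _ _ _ _ _ _ 1) => h /=.
    by rewrite /GRing.scale /=; ring.
have d0 (v : R * (R * R)) (a : R) : 'D_v (fun=> a) (s, z) = 0.
  by apply: (@derive_quadratic _ _ _ _ _ _ 0) => h; rewrite !mulr0 !addr0.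
by rewrite !d0 !oppr0.
Qed.

Lemma ham_lift_phase (phi : R * R -> R) (s tau : R) (z xi : R * R) :
  ham (lift_phase phi) ((s, z), (tau, xi)) =
    (0, (0, (- 'D_(1, 0) phi z, - 'D_(0, 1) phi z))).
Proof.
have d0 (W : normedModType R) (f : W -> R) w : 'D_0 f w = 0.
  by apply: (@derive_quadratic _ _ _ _ _ _ 0) => h; rewrite scaler0 add0r !mulr0 !addr0.
have d1 (v : R * (R * R)) (a : R) : 'D_v (fun=> a) (tau, xi) = 0.
  by apply: (@derive_quadratic _ _ _ _ _ _ 0) => h; rewrite !mulr0 !addr0.
rewrite /ham /grad /lift_phase /= !d1; congr (_, _).
have e (w : R) v : 'D_((w, v)) (fun y : R * (R * R) => phi y.2) (s, z) = 'D_v phi z by [].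
rewrite !e; have -> : 'D_(0, 0) phi z = 0 by exact: d0.
have opp (a b : R) : - ((0, (a, b)) : R * (R * R)) = (0, (- a, - b)) by rewrite -{2}oppr0.
exact: opp.
Qed.

End Symbol.

(** * The unit-speed path through a two-sided sequence of reflection points *)

Section Orbit.
Context {R : realType}.
Variables (c : int -> vertex) (p : int -> R * R).
Hypothesis c_neq : forall k : int, c (k + 1) <> c k.
Hypothesis p_circle : forall k, enorm (p k - center (c k)) = 1.
Let u (k : int) : R * R := unitv (p (k + 1) - p k).
Hypothesis u_out : forall k : int, 0 < dot (u k) (p k - center (c k)).
Hypothesis u_in : forall k : int, dot (u (k - 1)) (p k - center (c k)) < 0.
Hypothesis u_jump : forall k : int, exists m : R, u k - u (k - 1) = m *: (p k - center (c k)).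

Let ell (k : int) := enorm (p (k + 1) - p k).
Local Notation t := (clock ell).

Lemma p_disc k : disc (c k) (p k).
Proof. by rewrite /disc /= p_circle. Qed.

(** Along an edge the coordinate of the target vertex rises from at most 1 to at least 7. *)
Lemma ell_ge6 k : 6 <= ell k.
Proof.
have := lam_disc (p_disc (k + 1)); have := lam_disc_neq (nesym (@c_neq k)) (p_disc k).
have := lam_lip (c (k + 1)) (p (k + 1)) (p k); rewrite /ell; lra.
Qed.

Lemma ell_ge1 k : 1 <= ell k.
Proof. by have := ell_ge6 k; lra. Qed.

Let step k : p (k + 1) = p k + ell k *: u k.
Proof.
rewrite -unitvE ?[p k + _]addrC ?subrK // -enorm_gt0.
by apply: lt_le_trans (ell_ge1 k).
Qed.

Let u_norm k : enorm (u k) = 1.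
Proof. by apply: enorm_unitv; rewrite -enorm_gt0; apply: lt_le_trans (ell_ge1 k). Qed.

Definition orbit (s : R) : R * R :=
  p (tick ell s) + (s - t (tick ell s)) *: u (tick ell s).

(* tau = - 1 / 2, so that the parameter is the time. *)
Definition lifted_orbit (s : R) : (R * (R * R)) * (R * (R * R)) :=
  ((s, orbit s), (- 2^-1, 2^-1 *: u (tick ell s))).

(** At the right endpoint [tick] has already moved to [k + 1], but the two formulas agree there. *)
Lemma orbitE k s : t k <= s <= t (k + 1) -> orbit s = p k + (s - t k) *: u k.
Proof.
move=> /andP[h1]; rewrite le_eqVlt => /predU1P[->|h2]; last first.
  by rewrite /orbit (tickE ell_ge1 (k := k)) // h1.
rewrite /orbit (tickE ell_ge1 (k := k + 1)); last first.
  by rewrite lexx /= [ltRHS]clock_succ ltrDl (lt_le_trans ltr01 (ell_ge1 _)).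
by rewrite subrr scale0r addr0 clock_succ [X in X *: _]addrAC subrr add0r step.
Qed.

Lemma orbit_clock k : orbit (t k) = p k.
Proof.
rewrite (orbitE (k := k)) ?lexx ?subrr ?scale0r ?addr0 //=.
exact/(clock_le ell_ge1)/ler_wpDr.
Qed.

Lemma orbit_segment k s : t k <= s <= t (k + 1) ->
  exists2 r : R, 0 <= r <= 1 & orbit s = p k + r *: (p (k + 1) - p k).
Proof.
move=> h; have l0 : 0 < ell k := lt_le_trans ltr01 (ell_ge1 k).
exists ((s - t k) / ell k).
  move: h; rewrite clock_succ => /andP[h1 h2].
  by rewrite divr_ge0 ?subr_ge0 ?(ltW l0) //= ler_pdivrMr // mul1r; lra.
by rewrite (orbitE h) /u /unitv scalerA.
Qed.

(** The disc at the start is avoided by [u_out], and the one at the end by [u_in] applied to the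
    reversed ray. The coordinate of the remaining vertex is at most 1 at both ends, hence on the
    whole edge, while it is at least 7 on its disc. *)
Lemma orbit_domain k s : t k < s < t (k + 1) -> domain (orbit s).
Proof.
move=> h; have h' : t k <= s <= t (k + 1) by case/andP: h => /ltW -> /ltW.
have [r r01 hr] := orbit_segment h'; split.
  rewrite outer_gt0 hr; apply: le_lt_trans (enorm_segment _ _ r01) _.
  apply: convex_comb_lt => //.
    by have := disc_bounded (p_disc k); lra.
  by have := disc_bounded (p_disc (k + 1)); lra.
move=> j; rewrite circle_gt0; have [->|jk] := pselect (j = c k).
  rewrite (orbitE h'); apply: ray_outside => //; rewrite subr_gt0.
  by case/andP: h.
have [->|jk1] := pselect (j = c (k + 1)).
  have -> : orbit s = p (k + 1) + (t (k + 1) - s) *: - u k.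
    rewrite (orbitE h') step scalerN -scaleNr -addrA -scalerDl clock_succ.
    by congr (_ + _ *: _); ring.
  apply: ray_outside => //; last by rewrite subr_gt0; case/andP: h.
  have := u_in (k + 1); rewrite addrK; rewrite /dot /=; lra.
rewrite ltNge; apply/negP => /lam_disc.
have := lam_disc_neq (nesym jk) (p_disc k).
have := lam_disc_neq (nesym jk1) (p_disc (k + 1)).
rewrite hr lam_affine; case/andP: r01 => r0 r1; nra.
Qed.

Lemma orbit_lip_right k s s' : t k <= s -> t k <= s' -> s <= t (k + 1) ->
  s' <= t (k + 1) -> enorm (orbit s - orbit s') <= `|s - s'|.
Proof.
move=> h1 h2 h3 h4; rewrite (orbitE (k := k)) ?h1 // (orbitE (s := s') (k := k)) ?h2 //.
rewrite opprD addrACA subrr add0r -scalerBl enormZ u_norm mulr1.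
by rewrite opprB addrA subrK.
Qed.

(** The window reaches back to the previous edge so that it is a neighborhood of [s] even when [s]
    is the reflection time [t k]. *)
Lemma orbit_lip k s s' : t k <= s < t (k + 1) -> t (k - 1) <= s' < t (k + 1) ->
  enorm (orbit s - orbit s') <= `|s - s'|.
Proof.
move=> /andP[h1 h2] /andP[h3 h4]; have [h5|/ltW h5] := lerP (t k) s'.
  by apply: (@orbit_lip_right k) => //; exact: ltW.
have e : t (k - 1 + 1) = t k by rewrite subrK.
have h6 : t (k - 1) <= t k by exact: le_trans h3 h5.
have h7 : t k <= t (k + 1) by exact: le_trans h1 (ltW h2).
apply: le_trans (enorm_triangle (orbit (t k)) _ _) _.
have a := @orbit_lip_right k s (t k) h1 (lexx _) (ltW h2) h7.
have b := @orbit_lip_right (k - 1) (t k) s'; rewrite e in b.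
apply: le_trans (lerD a (b h6 h3 (lexx _) h5)) _.
by rewrite !ger0_norm ?subr_ge0 // ?addrA ?subrK // (le_trans h5).
Qed.

Lemma near_clock_window s :
  \forall s' \near s, t (tick ell s - 1) < s' < t (tick ell s + 1).
Proof.
have /andP[h1 h2] := tickP ell_ge1 s; near=> s'.
apply/andP; split; last by near: s'; exact: lt_nbhsl.
near: s'; apply: lt_nbhsr; apply: lt_le_trans h1.
by rewrite [ltRHS]clock_pred ltrDl (lt_le_trans ltr01 (ell_ge1 _)).
Unshelve. all: by end_near. Qed.

Lemma orbit_continuous : continuous orbit.
Proof.
move=> s; apply/cvgrPdist_le => e e0; near=> s'.
apply: le_trans (norm_le_enorm _) _; apply: (@le_trans _ _ `|s - s'|).
  apply: (orbit_lip (tickP ell_ge1 s)).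
  suff /andP[/ltW-> ->] : t (tick ell s - 1) < s' < t (tick ell s + 1) by [].
  by near: s'; exact: near_clock_window.
by near: s'; apply: cvgr_dist_le.
Unshelve. all: by end_near. Qed.

Lemma lifted_orbit_symbol s : wave_symbol (lifted_orbit s) = 0.
Proof.
have := sqr_enorm (u (tick ell s)); rewrite u_norm expr1n /dot -!expr2 => h.
rewrite /wave_symbol /lifted_orbit; move: (u _) h => w h /=; rewrite sqrrN.
by rewrite [X in X ^+ 2 + _]/GRing.scale [X in _ + X ^+ 2]/GRing.scale /= !exprMn -mulrDr -h mulr1 subrr.
Qed.

Lemma lifted_orbitB k s s' : t k < s < t (k + 1) -> t k < s' < t (k + 1) ->
  lifted_orbit s' - lifted_orbit s = (s' - s) *: ((1, u k), (0, (0, 0))).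
Proof.
move=> /andP[h1 h2] /andP[h1' h2'].
have e1 : tick ell s = k by apply: (tickE ell_ge1); rewrite ltW.
have e2 : tick ell s' = k by apply: (tickE ell_ge1); rewrite ltW.
rewrite /lifted_orbit /orbit e1 e2.
have aux (a b : R) (v w z w' : R * R) (m m' : R) :
    ((a, v), (m, w)) - ((b, z), (m', w')) = ((a - b, v - z), (m - m', w - w')) by [].
rewrite aux !subrr opprD addrACA subrr add0r -scalerBl opprB addrA subrK.
have aux2 (a : R) (v : R * R) : a *: ((1 : R, v), (0 : R, (0 : R, 0 : R))) =
    ((a, a *: v), (0, 0)).
  by rewrite -{2}(mulr1 a) -{4}(mulr0 a) -[in RHS](scaler0 _ a).
by rewrite aux2.
Qed.

Lemma lifted_orbit_interior s : ~ range t s ->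
  interior_motion domain (range t) lifted_orbit s.
Proof.
move=> /(not_in_range_clock ell_ge1); set k := tick ell s => hs.
split; first exact: (@orbit_domain k).
have -> : ham wave_symbol (lifted_orbit s) = ((1, u k), (0, (0, 0))).
  rewrite /lifted_orbit ham_wave_symbol -/k scalerA mulfV // scale1r.
  by rewrite mulrNN mulfV.
apply: cvg_near_cst; apply: cvg_within.
have /andP[h1 h2] := hs; near=> h.
have h0 : h != 0 by near: h; exact: nbhs_dnbhs_neq.
rewrite (@lifted_orbitB k) // ?scalerA 1?addrC ?addKr ?mulVf ?scale1r //.
near: h; apply: nbhs_dnbhs; apply/nbhs_ballP.
exists (Num.min (s - t k) (t (k + 1) - s)); first by rewrite /= lt_min !subr_gt0.
move=> h /=; rewrite /ball /= sub0r normrN lt_min => /andP[].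
by rewrite !ltr_norml; lra.
Unshelve. all: by end_near. Qed.

Lemma tick_clock k : tick ell (t k) = k.
Proof.
apply: (tickE ell_ge1); rewrite lexx clock_succ ltrDl.
by apply: lt_le_trans ltr01 _; exact: ell_ge1.
Qed.

Lemma lifted_orbit_reflection k : reflection domain (range t) lifted_orbit (t k).
Proof.
have /andP[k1 k2] : t (k - 1) < t k < t (k + 1).
  have l0 j : 0 < ell j by apply: lt_le_trans ltr01 _; exact: ell_ge1.
  by apply/andP; split; [rewrite [ltRHS]clock_pred|rewrite clock_succ]; rewrite ltrDl l0.
have win : \forall s \near t k, t (k - 1) < s < t (k + 1).
  by have := near_clock_window (t k); rewrite tick_clock.
split.
  near=> s; have sk : s != t k by near: s; exact: nbhs_dnbhs_neq.
  have /andP[h1 h2] : t (k - 1) < s < t (k + 1).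
    by near: s; exact: nbhs_dnbhs win.
  have [j hj] : exists j, t j < s < t (j + 1).
    move: sk; case: ltgtP => // h _; [exists (k - 1)|exists k]; rewrite ?subrK ?h1 ?h2 ?h //.
  by split; [apply: (clock_not_in_range ell_ge1 hj)|exact: orbit_domain hj].
have [m hm] := u_jump k.
pose rho (w : R * R) : (R * (R * R)) * (R * (R * R)) := ((t k, p k), (- 2^-1, 2^-1 *: w)).
(* The momentum is half the velocity and jumps by [m / 2] times the normal, while the fibre part of
   the Hamiltonian field of [circle] is -2 times the normal; hence [- (m / 4)]. *)
exists (rho (u (k - 1))), (rho (u k)), (circle (c k)), (- (m / 4)); split.
- rewrite /lifted_orbit /rho; apply: cvg_to_pair.
    apply: cvg_to_pair; first exact: cvg_within.
    by rewrite -orbit_clock; apply: cvg_within_filter; exact: orbit_continuous.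
  apply: cvg_near_cst; near=> s; congr (_, _ *: u _); apply: (tickE ell_ge1).
  rewrite subrK; apply/andP; split; last by near: s; exact: nbhs_left_lt.
  by apply: ltW; near: s; exact: nbhs_left_gt.
- rewrite /lifted_orbit /rho; apply: cvg_to_pair.
    apply: cvg_to_pair; first exact: cvg_within.
    by rewrite -orbit_clock; apply: cvg_within_filter; exact: orbit_continuous.
  apply: cvg_near_cst; near=> s; congr (_, _ *: u _); apply: (tickE ell_ge1).
  apply/andP; split; last by near: s; exact: nbhs_right_lt.
  by apply: ltW; near: s; exact: nbhs_right_gt.
(* Equal momenta would give equal velocities, against the opposite signs in [u_in] and [u_out]. *)
- move=> /(congr1 (fun r => 2 *: r.2.2)) /=.
  have half (w : R * R) : 2 *: (2^-1 *: w) = w by rewrite scalerA mulfV // scale1r.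
  rewrite !half => e.
  by have := u_in k; rewrite e; have := u_out k; lra.
- apply: boundary_circle.
  + by rewrite circleE p_circle expr1n subrr.
  + by move=> j jk; apply: disc_circle_gt0 jk; exact: p_disc.
  + exact: disc_outer_gt0 (p_disc k).
- rewrite ham_lift_phase /rho /= !derive_quadE.
  have -> : u k = u (k - 1) + m *: (p k - center (c k)) by rewrite -hm addrC subrK.
  have aux (a b r : R) (v w z : R * R) :
      ((a, v), (b, w)) + r *: (0, (0, z)) = ((a, v), (b, w + r *: z)).
    have -> : ((a, v), (b, w)) + r *: (0, (0, z)) =
        ((a + r * 0, v + r *: 0), (b + r * 0, w + r *: z)) by [].
    by rewrite mulr0 scaler0 !addr0.
  rewrite aux scalerDr; congr (_, (_, _ + _)).
  move: (p k) (center (c k)) => q o; apply/pair_eqP; rewrite /pair_eq /dot /=.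
  by apply/andP; split; apply/eqP; rewrite /GRing.scale /=; field.
Unshelve. all: by end_near. Qed.

Lemma orbit_geodesic : generalized_geodesic domain orbit.
Proof.
split; first exact: orbit_continuous.
exists (range t), lifted_orbit; split => //; split.
  move=> s nB; split; first exact: lifted_orbit_symbol.
    by case=> h; exfalso; move: h; lra.
  by left; exact: lifted_orbit_interior.
by move=> s [k _ <-]; exact: lifted_orbit_reflection.
Qed.

End Orbit.

(** * Shortest closed polygons *)

Section ClosedBilliard.
Context {R : realType}.

Lemma disc_compact k : compact (@disc R k).
Proof.
have cont : continuous (fun z : R * R => enorm (z - center k)).
  move=> z; apply: continuous_comp; last exact: enorm_continuous.
  by apply: cvgB; [exact: cvg_id|exact: cvg_cst].
have dcl : closed ((fun z : R * R => enorm (z - center k)) @^-1` [set x | x <= 1]).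
  by apply: preimage_closed => [z _|]; [exact: cont|exact: closed_le].
apply: (subclosed_compact dcl (compact_setX (@segment_compact R (- 9) 9) (@segment_compact R (- 9) 9))).
move=> z /disc_bounded z9; have := normr1_le_enorm z; have := normr2_le_enorm z.
by rewrite !ler_norml; split; rewrite /= in_itv /=; lra.
Qed.

Variable m : nat.
Local Notation I := 'I_m.+2.
Implicit Types (w : I -> vertex) (p q : I -> R * R) (i : I).

(** Addition in ['I_m.+2] is cyclic, so the closing edge is included. *)
Definition closed_length p : R := \sum_i enorm (p (i + 1) - p i).

Lemma closed_length_continuous :
  continuous (closed_length : prod_topology (fun _ : I => (R * R)%type) -> R).
Proof.
move=> f; have FF := nbhs_filter f; apply: cvg_big => [|i _]; first exact: add_continuous.
apply: (@continuous_comp _ _ _ (fun g : prod_topology (fun _ : I => (R * R)%type) =>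
  g (i + 1) - g i)); last exact: enorm_continuous.
apply: cvgB; first exact: (@proj_continuous I (fun=> (R * R)%type) (i + 1) f).
exact: (@proj_continuous I (fun=> (R * R)%type) i f).
Qed.

Lemma closed_length_minimizer w : exists2 p, (forall i, disc (w i) (p i)) &
  forall q, (forall i, disc (w i) (q i)) -> closed_length p <= closed_length q.
Proof.
have := tychonoff (fun i => @disc_compact (w i)).
set A := [set f | _] => cA.
have A0 : A !=set0 by exists (fun i => center (w i)) => i; rewrite /disc /= subrr enorm0.
have [|p /set_mem pA pmin] := compact_EVT_min (T := prod_topology (fun=> (R * R)%type)) (f := closed_length) A0 cA.
  by apply: continuous_subspaceT; exact: closed_length_continuous.
by exists p => // q hq; apply: pmin; rewrite inE.
Qed.

Lemma succ_neq i : i + 1 != i.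
Proof. by rewrite -subr_eq0 addrAC subrr add0r. Qed.

Lemma pred_neq i : i - 1 != i.
Proof. by rewrite -subr_eq0 addrAC subrr add0r oppr_eq0. Qed.

(** Moving vertex [i] alone affects only the edges [i] and [i - 1]. These are distinct indices even
    for two vertices, when both neighbors coincide. *)
Lemma minimizer_vertex w p : (forall i, disc (w i) (p i)) ->
  (forall q, (forall i, disc (w i) (q i)) -> closed_length p <= closed_length q) ->
  forall i z, disc (w i) z ->
    enorm (p (i + 1) - p i) + enorm (p (i - 1) - p i) <=
    enorm (p (i + 1) - z) + enorm (p (i - 1) - z).
Proof.
move=> pD pmin i z zD; pose q j := if j == i then z else p j.
have /pmin : forall j, disc (w j) (q j).
  by move=> j; rewrite /q; case: eqP => // ->.
rewrite /closed_length (bigD1 i) //= (bigD1 (i - 1)) ?pred_neq //= [leRHS](bigD1 i) //=.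
rewrite [in leRHS](bigD1 (i - 1)) ?pred_neq //= !subrK.
rewrite /q eqxx (negbTE (succ_neq i)) (negbTE (pred_neq i)).
set s1 := \sum_(_ | _) _; set s2 := \sum_(_ | _) _.
have -> : s1 = s2.
  apply: eq_bigr => j /andP[ji ji1]; rewrite (negbTE ji).
  suff /negbTE -> : j + 1 != i by [].
  by apply: contra ji1 => /eqP <-; rewrite addrK.
rewrite (enormB (p i)) (enormB z); lra.
Qed.

(** [lam k] strictly decreases from [p] towards [a] and towards [b], so the two directions cannot be
    opposite: a shortest polygon never passes straight through a disc. *)
Lemma no_eclipse k (a b p : R * R) : lam k a <= 1 -> lam k b <= 1 -> 7 <= lam k p ->
  unitv (a - p) + unitv (b - p) != 0.
Proof.
move=> ka kb kp.
have neq d : lam k d <= 1 -> 0 < (enorm (d - p))^-1.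
  move=> kd; rewrite invr_gt0 enorm_gt0 subr_eq0; apply/eqP => dp.
  by move: kd; rewrite dp; lra.
apply/eqP => G0; have : (enorm (a - p))^-1 * (lam k a - lam k p) +
    (enorm (b - p))^-1 * (lam k b - lam k p) = 0.
  (* Subtracting [lam k 0] leaves the linear part of the affine function [lam k]. *)
  have -> : 0 = lam k (unitv (a - p) + unitv (b - p)) - lam k 0 by rewrite G0 subrr.
  rewrite /unitv; move: (enorm (a - p))^-1 (enorm (b - p))^-1 => al be.
  by case: k {ka kb kp neq G0} => /=; rewrite /GRing.scale /=; field.
have := neq a ka; have := neq b kb; nra.
Qed.

Lemma closed_billiard w : (forall i, w (i + 1) <> w i) ->
  exists2 p, (forall q, (forall i, disc (w i) (q i)) -> closed_length p <= closed_length q) &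
  forall i, let u := unitv (p (i + 1) - p i) in let u' := unitv (p i - p (i - 1)) in
  let n := p i - center (w i) in
  [/\ enorm n = 1, 0 < dot u n, dot u' n < 0 & exists r : R, u - u' = r *: n].
Proof.
move=> wneq; have [p pD pmin] := closed_length_minimizer w.
exists p => // i /=; have min := minimizer_vertex pD pmin (i := i).
have wneq' : w (i - 1) <> w i by have := wneq (i - 1); rewrite subrK => /nesym.
have la := lam_disc_neq (@wneq i) (pD (i + 1)).
have lb := lam_disc_neq wneq' (pD (i - 1)).
have lp := lam_disc (pD i).
have ap : p (i + 1) != p i by apply/eqP => e; move: la; rewrite e; lra.
have bp : p (i - 1) != p i by apply/eqP => e; move: lb; rewrite e; lra.
have G0 := no_eclipse la lb lp.
have e := disc_minimizer (pD i) ap bp G0 min.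
have [h1 h2] := disc_reflection ap bp e G0.
have -> : p i - p (i - 1) = - (p (i - 1) - p i) by rewrite opprB.
rewrite unitvN; split => //.
- by rewrite e enorm_unitv.
- by move: h2; rewrite /dot /=; lra.
- exists (enorm (unitv (p (i + 1) - p i) + unitv (p (i - 1) - p i))).
  by rewrite e -unitvE // opprK.
Qed.

End ClosedBilliard.

(** * Infimal lengths of open polygons with a given itinerary *)

Section Itinerary.
Context {R : realType}.
Implicit Types (w : nat -> vertex) (q : nat -> R * R) (k : nat).

Definition visits w k q := forall i, (i <= k)%N -> disc (w i) (q i).

Definition path_length q k : R := \sum_(0 <= i < k) enorm (q i.+1 - q i).

(** A stand-in for the arrival time at disc [k] that depends only on the letters up to [k], whereas
    the true time depends on the whole closed word. *)
Definition itinerary_length w k : R :=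
  inf [set path_length q k | q in visits w k].

Lemma path_length_ge0 q k : 0 <= path_length q k.
Proof. by apply: sumr_ge0 => i _; exact: enorm_ge0. Qed.

Lemma visits_center w k : visits w k (fun i => center (w i)).
Proof. by move=> i _; rewrite /disc /= subrr enorm0. Qed.

Lemma itinerary_length_le w k q : visits w k q -> itinerary_length w k <= path_length q k.
Proof.
move=> hq; apply: ge_inf; last by exists q.
by exists 0 => _ [q' _ <-]; exact: path_length_ge0.
Qed.

Lemma itinerary_length_near w k : exists2 q, visits w k q &
  path_length q k <= itinerary_length w k + 1.
Proof.
have hI : has_inf [set path_length q k | q in visits w k].
  split; first by exists (path_length (fun i => center (w i)) k); exists (fun i => center (w i)) => //; exact: visits_center.
  by exists 0 => _ [q' _ <-]; exact: path_length_ge0.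
by have [_ [q hq <-] /ltW] := inf_adherent ltr01 hI; exists q.
Qed.

Lemma itinerary_length_ge0 w k : 0 <= itinerary_length w k.
Proof.
apply: lb_le_inf; last by move=> _ [q _ <-]; exact: path_length_ge0.
by exists (path_length (fun i => center (w i)) k); exists (fun i => center (w i)) => //; exact: visits_center.
Qed.

Lemma eq_itinerary_length w w' k : (forall i, (i <= k)%N -> w i = w' i) ->
  itinerary_length w k = itinerary_length w' k.
Proof.
move=> ww; congr (inf _); apply/seteqP.
by split=> _ [q hq <-]; exists q => // i ik; [rewrite -ww|rewrite ww] => //; exact: hq.
Qed.

(** Dropping the last point gives the lower bound. For the upper one, a path within 1 of the infimum
    is prolonged to the next center, at distance at most 8 + 9. *)
Lemma itinerary_length_succ w k :
  itinerary_length w k <= itinerary_length w k.+1 <= itinerary_length w k + 18.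
Proof.
apply/andP; split.
  apply: lb_le_inf.
    by exists (path_length (fun i => center (w i)) k.+1); exists (fun i => center (w i)) => //; exact: visits_center.
  move=> _ [q hq <-]; rewrite /path_length big_nat_recr //=.
  apply: le_trans (itinerary_length_le (q := q) _) _.
    by move=> i ik; apply: hq; exact: leqW.
  by rewrite lerDl enorm_ge0.
have [q hq hl] := itinerary_length_near w k.
pose q' i := if (i <= k)%N then q i else center (w i).
have : visits w k.+1 q'.
  move=> i _; rewrite /q'; case: ifP => [ik|_]; first exact: hq.
  by rewrite /disc /= subrr enorm0.
move=> /itinerary_length_le /le_trans; apply.
rewrite /path_length big_nat_recr //= [X in X + _](_ : _ = path_length q k); last first.
  by apply: eq_big_nat => i /andP[_ ik]; rewrite /q' ik ltnW.
rewrite {1 2}/q' ltnn leqnn.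
have h1 : enorm (q k) <= 9 by apply: (@disc_bounded _ (w k)); exact: hq.
have h2 : enorm (center (w k.+1)) <= 8 :> R.
  rewrite -(@ler_pXn2r _ 2) ?nnegrE ?enorm_ge0 // sqr_enorm /dot.
  by case: (w k.+1) => /=; lra.
have := enormD (center (w k.+1)) (- q k); rewrite enormN; lra.
Qed.

End Itinerary.

(** * Arrival times compared with itinerary lengths *)

Section Follow.
Context {R : realType}.
Variables (m : nat) (w : 'I_m.+2 -> vertex) (p : 'I_m.+2 -> R * R).
Hypothesis pD : forall i, disc (w i) (p i).
Hypothesis pmin : forall q, (forall i, disc (w i) (q i)) ->
  closed_length p <= closed_length q.

Let pn (i : nat) := p i%:R.

Lemma closed_lengthE (q : 'I_m.+2 -> R * R) :
  closed_length q = path_length (fun i => q i%:R) m.+2.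
Proof.
rewrite /closed_length /path_length big_mkord; apply: eq_bigr => i _.
by rewrite -natr1 natr_Zp.
Qed.

Lemma val_natr (i : nat) : (i < m.+2)%N -> ((i%:R : 'I_m.+2) : nat) = i.
Proof. by move=> im; rewrite Zp_nat /= modn_small. Qed.

Lemma natr_period : m.+2%:R = 0%:R :> 'I_m.+2.
Proof. by rewrite Zp_nat; apply/val_inj; rewrite /= modnn. Qed.

Lemma itinerary_length_le_clock (v : nat -> vertex) k :
  (forall i, (i <= k)%N -> v i = w i%:R) ->
  itinerary_length v k <= path_length pn k.
Proof. by move=> vw; apply: itinerary_length_le => i ik; rewrite vw. Qed.

(* Replacing the first [k] vertices of the shortest closed polygon by a nearly
   shortest open path only affects the two junctions, by a diameter each. *)
Lemma clock_le_itinerary_length (v : nat -> vertex) k : (k <= m)%N ->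
  (forall i, (i <= k)%N -> v i = w i%:R) ->
  path_length pn k <= itinerary_length v k + 5.
Proof.
move=> km vw; have [q hq hl] := itinerary_length_near (R := R) v k.
pose p' (i : 'I_m.+2) := if (i <= k)%N then q i else p i.
have h2 i : (i <= k)%N -> enorm (q i - pn i) <= 2.
  move=> ik; have := hq i ik; have := pD i%:R; rewrite vw // /disc /= => a b.
  have := enorm_triangle (center (w i%:R)) (q i) (pn i).
  by rewrite (enormB (center _)); rewrite /pn; lra.
have p'E (i : nat) : (i < m.+2)%N -> p' i%:R = if (i <= k)%N then q i else pn i.
  by move=> im; rewrite /p' val_natr.
have p'n : p' m.+2%:R = q 0%N by rewrite natr_period p'E.
have pn2 : p m.+2%:R = pn 0%N by rewrite natr_period.
have : closed_length p <= closed_length p'.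
  apply: pmin => i; rewrite /p'; case: ifP => // ik.
  by have := hq i ik; rewrite vw // natr_Zp.
have km1 : (k <= m.+1)%N := leqW km; have km2 : (k <= m.+2)%N := leqW km1.
rewrite !closed_lengthE /path_length.
rewrite (@big_cat_nat _ _ _ k) //=.
rewrite [leRHS](@big_cat_nat _ _ _ k) //=.
rewrite [X in _ <= X + _](_ : _ = path_length q k); last first.
  apply: eq_big_nat => i /andP[_ ik]; have im : (i < m.+1)%N by rewrite (leq_trans ik) // leqW.
  by rewrite !p'E // ?ik ?(ltnW ik) // ltnW.
rewrite (@big_ltn _ _ _ k) //.
rewrite [in leRHS](@big_ltn _ _ _ k) //.
rewrite big_nat_recr ?ltnS //= [in leRHS]big_nat_recr ?ltnS //=.
rewrite [X in _ <= _ + (_ + (X + _))](_ : _ =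
    \sum_(k.+1 <= i < m.+1) enorm (p i.+1%:R - p i%:R)); last first.
  apply: eq_big_nat => i /andP[ki im].
  have kf j : (k < j)%N -> (j <= k)%N = false by move=> kj; apply/negbTE; rewrite -ltnNge.
  by rewrite !p'E //; [rewrite !kf // ltnW|exact: ltnW].
rewrite p'n pn2 !p'E // ltnn leqnn [(m.+1 <= k)%N]ltnNge km /=.
(* The edges from [k] to [k.+1] and from [m.+1] back to 0 are the junctions. Each costs at most 2,
   and [q] exceeds the infimum by at most 1, whence 5. *)
have := h2 k (leqnn k); have := h2 0%N (leq0n k); rewrite (enormB (q k)).
have := enorm_triangle (pn k) (pn k.+1) (q k).
have := enorm_triangle (pn 0%N) (q 0%N) (pn m.+1).
rewrite /pn; lra.
Qed.

End Follow.

(** * Avoiding the observer *)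

Section Strategy.
Context {R : realType}.
Variables (T v : R) (x : R -> R * R).
Hypothesis T0 : 0 < T.
Hypothesis v_small : 0 <= v <= 80^-1.
Hypothesis x_slow : forall a b : R, 0 <= a -> a <= b -> b <= T ->
  enorm (x b - x a) <= v * (b - a).
Implicit Types (w : nat -> vertex) (k : nat).

(** The observer at the estimated arrival time, cut off at [T] because the speed bound stops
    there. *)
Definition sighting w k : R * R := x (Num.min (itinerary_length w k) T).

Definition avoiding w k := w k.+1 <> w k /\
  exists l, [/\ l <> w k, l <> w k.+1 & 2 <= lam l (sighting w k)].

(** The two times differ by at most 18, and 18 / 80 is below 1 / 2. *)
Lemma sighting_succ w k l :
  `|lam l (sighting w k.+1) - lam l (sighting w k)| <= 2^-1.
Proof.
have /andP[h1 h2] := itinerary_length_succ (R := R) w k.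
have h0 := itinerary_length_ge0 (R := R) w k.
set a := Num.min (itinerary_length w k) T; set b := Num.min (itinerary_length w k.+1) T.
have a0 : 0 <= a by rewrite le_min h0 ltW.
have ab : a <= b by rewrite le_min !ge_min lexx orbT h1.
have bT : b <= T by rewrite ge_min lexx orbT.
have ba : b - a <= 18.
  rewrite /a; case: (leP (itinerary_length w k) T) => h; last lra.
  have : b <= itinerary_length w k.+1 by rewrite ge_min lexx.
  lra.
have := x_slow a0 ab bT; have /andP[v0 v1] := v_small.
have : v * (b - a) <= 80^-1 * 18 by apply: ler_pM => //; rewrite subr_ge0.
have := lam_lip l (x b) (x a); have := lam_lip l (x a) (x b).
rewrite (enormB (x a)) ler_norml /sighting -/a -/b; lra.
Qed.

(** On the diagonal it still returns a vertex other than [i]; the start of the itinerary and the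
    closing letter of a cyclic word rely on this. *)
Definition third (i j : vertex) : vertex :=
  match i, j with
  | Va, Vb | Vb, Va => Vc
  | Va, _ | Vc, Va => Vb
  | _, _ => Va
  end.

Lemma third_neq i j : third i j <> i /\ third i j <> j.
Proof. by case: i; case: j. Qed.

(* The coordinate 2 + 1/2 leaves room for the motion of the observer before the
   next choice. *)
Lemma next_edge i (z : R * R) : (exists2 l, l <> i & 2 <= lam l z) ->
  exists j l, [/\ j <> i, l <> i, l <> j, 2 <= lam l z &
    exists2 l', l' <> j & 2 + 2^-1 <= lam l' z].
Proof.
have key a b : a <> i -> b <> i -> a <> b -> lam i z + lam a z + lam b z = 8 ->
    lam b z <= lam a z -> 2 <= lam a z ->
    exists j l, [/\ j <> i, l <> i, l <> j, 2 <= lam l z &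
      exists2 l', l' <> j & 2 + 2^-1 <= lam l' z].
  move=> ai bi ab hs ba a2; exists b, a; split=> //.
  (* The ray heads for [b], the smaller of the two coordinates. If [lam a z] is below 2 + 1/2, so is
     [lam b z], and the total 8 leaves more than 3 for [lam i z]. *)
  have [h|h] := lerP (2 + 2^-1) (lam a z); first by exists a.
  by exists i; [exact: nesym|lra].
have hs := lam_sum z.
have key2 a b : a <> i -> b <> i -> a <> b -> lam i z + lam a z + lam b z = 8 ->
    2 <= lam a z \/ 2 <= lam b z ->
    exists j l, [/\ j <> i, l <> i, l <> j, 2 <= lam l z &
      exists2 l', l' <> j & 2 + 2^-1 <= lam l' z].
  move=> ai bi ab hab h2; have [h|/ltW h] := lerP (lam b z) (lam a z).
    by apply: (key a b) => //; case: h2; lra.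
  by apply: (key b a) => //; [exact: nesym|lra|case: h2; lra].
move=> [l li l2]; have [l1 [l1' [h1 h2 h3 h4 h5]]] : exists a b,
    [/\ a <> i, b <> i, a <> b, lam i z + lam a z + lam b z = 8 & l = a \/ l = b].
  exists l, (third i l); have [h3 h4] := third_neq i l; split=> //.
  - exact: nesym.
  - by case: i l li {l2 h3 h4 key key2} => [] [] //= _; lra.
  - by left.
by apply: (key2 l1 l1') => //; case: h5 => <-; [left|right].
Qed.

(** The last clause is the invariant that lets [next_edge] choose the next letter. [next_edge]
    restores it with a margin 1/2, which [sighting_succ] consumes. *)
Lemma strategy N : exists w, (forall k, (k < N)%N -> avoiding w k) /\
  exists2 l, l <> w N & 2 <= lam l (sighting w N).
Proof.
elim: N => [|N [w [wa winv]]].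
  have s0 w : sighting w 0 = x 0.
    rewrite /sighting; have -> : itinerary_length w 0 = 0 :> R.
      apply/eqP; rewrite eq_le itinerary_length_ge0 andbT.
      apply: le_trans (itinerary_length_le (@visits_center _ w 0)) _.
      by rewrite /path_length big_geq.
    by rewrite min_l // ltW.
  have [l hl] : exists l, 2 <= lam l (x 0).
    have := lam_sum (x 0); have [ha _|ha] := lerP 2 (lam Va (x 0)); first by exists Va.
    have [hb _|hb] := lerP 2 (lam Vb (x 0)); first by exists Vb.
    by move=> hs; exists Vc; lra.
  exists (fun=> third l l); split=> //; exists l; last by rewrite s0.
  by have [h _] := third_neq l l; exact: nesym.
have [j [l [ji li lj l2 [l' l'j hl']]]] := next_edge winv.
pose w' i := if (i <= N)%N then w i else j.
have ww k : (k <= N)%N -> sighting w' k = sighting w k.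
  move=> kN; rewrite /sighting (@eq_itinerary_length _ w' w) // => i ik.
  by rewrite /w' (leq_trans ik kN).
exists w'; split; last first.
  exists l'; first by rewrite /w' ltnn.
  have := sighting_succ w' N l'; rewrite (ww N) // ler_norml; lra.
move=> k; rewrite ltnS leq_eqVlt => /predU1P[->|kN].
  rewrite /avoiding ww // /w' ltnn leqnn; split=> //; by exists l.
have [h1 [l1 [h2 h3 h4]]] := wa k kN.
rewrite /avoiding ww ?(ltnW kN) // /w' kN (ltnW kN); split => //.
by exists l1.
Qed.

End Strategy.

(** * The periodic geodesic following a finite word *)

Section Escape.
Context {R : realType}.
Variables (m : nat) (w : nat -> vertex).
Hypothesis w_neq : forall k, (k < m)%N -> w k.+1 <> w k.

(* The extra last letter makes the cyclic word have distinct neighbours. *)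
Definition cyclic_word (i : 'I_m.+2) : vertex :=
  if (i <= m)%N then w i else third (w m) (w 0%N).

Lemma cyclic_word_natr k : (k <= m)%N -> cyclic_word k%:R = w k.
Proof. by move=> km; rewrite /cyclic_word val_natr ?km // ltnS leqW. Qed.

Lemma cyclic_word_last : cyclic_word m.+1%:R = third (w m) (w 0%N).
Proof. by rewrite /cyclic_word val_natr ?ltnn. Qed.

Lemma cyclic_word_neq i : cyclic_word (i + 1) <> cyclic_word i.
Proof.
have [t1 t2] := third_neq (w m) (w 0%N).
rewrite -[i]natr_Zp natr1; case: i => i /=; rewrite !ltnS leq_eqVlt => /predU1P[->|].
  by rewrite natr_period (cyclic_word_natr (leq0n m)) cyclic_word_last; exact: nesym.
rewrite ltnS leq_eqVlt => /predU1P[->|im].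
  by rewrite cyclic_word_last (cyclic_word_natr (leqnn m)).
by rewrite (cyclic_word_natr im) (cyclic_word_natr (ltnW im)); exact: w_neq.
Qed.

Lemma escaping_geodesic : exists (y : R -> R * R) (t : nat -> R),
  [/\ generalized_geodesic domain y, t 0%N = 0,
    forall k, t k + 6 <= t k.+1 <= t k + 18,
    forall k, (k <= m)%N -> itinerary_length w k <= t k <= itinerary_length w k + 5 &
    forall s : R, 0 <= s -> exists2 k, t k <= s < t k.+1 &
      (k < m)%N -> forall l, l <> w k -> l <> w k.+1 -> lam l (y s) <= 1].
Proof.
have [p pmin hp] := closed_billiard (R := R) cyclic_word_neq.
have pD i : disc (cyclic_word i) (p i) by rewrite /disc /=; have [-> _ _ _] := hp i.
(* Reducing integers modulo [m.+2] unfolds the closed polygon into a two-sided periodic orbit. *)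
pose P (k : int) := p k%:~R; pose c (k : int) := cyclic_word k%:~R.
have P1 k : P (k + 1) = p (k%:~R + 1) by rewrite /P intrD.
have PB1 k : P (k - 1) = p (k%:~R - 1) by rewrite /P intrB.
have c_neq k : c (k + 1) <> c k by rewrite /c intrD; exact: cyclic_word_neq.
have P_circle k : enorm (P k - center (c k)) = 1 by have [] := hp k%:~R.
have P_out k : 0 < dot (unitv (P (k + 1) - P k)) (P k - center (c k)).
  by rewrite P1; have [] := hp k%:~R.
have P_in k : dot (unitv (P (k - 1 + 1) - P (k - 1))) (P k - center (c k)) < 0.
  by rewrite subrK PB1; have [] := hp k%:~R.
have P_jump k : exists r : R, unitv (P (k + 1) - P k) -
    unitv (P (k - 1 + 1) - P (k - 1)) = r *: (P k - center (c k)).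
  by rewrite subrK PB1 P1; have [] := hp k%:~R.
pose ell (k : int) := enorm (P (k + 1) - P k).
have ell6 k : 6 <= ell k by apply: (ell_ge6 c_neq P_circle).
have ell1 k : 1 <= ell k by have := ell6 k; lra.
have ell18 k : ell k <= 18.
  have := enormD (P (k + 1)) (- P k); rewrite enormN /ell.
  have := disc_bounded (p_disc P_circle k); have := disc_bounded (p_disc P_circle (k + 1)).
  lra.
have succZ k : k.+1%:Z = k%:Z + 1 by rewrite -addn1 PoszD.
have cw k : (k <= m)%N -> c k%:Z = w k by exact: cyclic_word_natr.
exists (orbit P), (fun k => clock ell k%:Z); split.
- exact: orbit_geodesic c_neq P_circle P_out P_in P_jump.
- exact: clock0.
- by move=> k; rewrite succZ clock_succ lerD2l ell6 lerD2l ell18.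
- move=> k km; have -> : clock ell k%:Z = path_length (fun i => p i%:R) k.
    rewrite /clock /path_length big_mkord; apply: eq_bigr => i _.
    by rewrite /ell -succZ.
  have cw' i : (i <= k)%N -> w i = cyclic_word i%:R.
    by move=> ik; rewrite cyclic_word_natr // (leq_trans ik).
  by rewrite (itinerary_length_le_clock pD) // (clock_le_itinerary_length pD pmin).
- move=> s s0; have [k ks] := clock_locate ell1 s.
  have k0 : 0 <= k.
    rewrite -ltzD1 ltNge; apply/negP => /(clock_le ell1); rewrite clock0.
    by case/andP: ks; lra.
  case: k k0 ks => // k _ ks; exists k; first by rewrite succZ.
  move=> km l lk lk1.
  have [|r /andP[r0 r1] ->] := orbit_segment c_neq P_circle (k := k%:Z) (s := s).
    by case/andP: ks => -> /ltW.
  rewrite lam_affine.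
  have : lam l (P k%:Z) <= 1.
    by apply: (lam_disc_neq (j := c k%:Z)) (p_disc P_circle _); rewrite cw ?(ltnW km) //; exact: nesym.
  have : lam l (P (k%:Z + 1)) <= 1.
    apply: (lam_disc_neq (j := c (k%:Z + 1))) (p_disc P_circle _).
    by rewrite -succZ cw //; exact: nesym.
  nra.
Qed.

End Escape.

Theorem theorem2 (R : realType) :
  exists X : set (R * R), smooth_bounded_domain X /\
  exists eps0 v0 : R, 0 < eps0 /\ 0 < v0 /\
  forall eps v : R, 0 < eps < eps0 -> 0 < v < v0 ->
  forall (T : R) (x : R -> R * R), 0 < T ->
    (forall t : R, 0 <= t <= T -> X (x t)) ->
    absolutely_continuous 0 T x ->
    (speed_sup T x <= v%:E)%E ->
    ~ tGCC X (fun t => eball (x t) eps `&` X) T.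
Proof.
exists domain; split; first exact: domain_smooth_bounded.
(* Since the sighting the observer loses at most 23 / 80 of a coordinate that was at least 2, while
   the ray has at most 1 there; the remaining gap exceeds 1 / 2. *)
exists 2^-1, 80^-1; rewrite !invr_gt0; do 2 split=> //.
move=> eps v /andP[eps0 eps1] /andP[v0 v1] T x T0 _ ac xv.
have x_slow := slow_path (ltW v0) ac xv.
have v_small : 0 <= v <= 80^-1 by rewrite !ltW.
have [m Tm] : exists m : nat, T < m%:R.
  by exists (Num.bound T); exact/archi_boundP/ltW.
have [w [w_avoids _]] := strategy T0 v_small x_slow m.
have [y [t [ygeo t0 tstep tM yseg]]] := escaping_geodesic (R := R) (fun k km => (w_avoids k km).1).
move=> /(_ y ygeo)[s [/andP[s0 sT] [xy _]]].
have [k /andP[ks sk] hk] := yseg s (ltW s0).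
(* Each edge takes time at least 1, so [m > T] letters suffice to cover [[0, T]]. *)
have tk j : j%:R <= t j.
  elim: j => [|j IH]; first by rewrite t0.
  by have /andP[h _] := tstep j; rewrite -natr1; lra.
have km : (k < m)%N.
  rewrite ltnNge; apply/negP => mk; have : m%:R <= k%:R :> R by rewrite ler_nat.
  by have := tk k; lra.
have [_ [l [lk lk1 l2]]] := w_avoids k km.
have ly := hk km l lk lk1.
have /andP[M1 M2] := tM k (ltnW km); have /andP[_ step] := tstep k.
have M0 := itinerary_length_ge0 (R := R) w k.
(* The cut-off at [T] is inactive: the itinerary length is at most [t k], hence at most [s], which
   is below [T]. *)
move: l2; rewrite /sighting min_l; last lra.
have Ms : itinerary_length w k <= s by lra.
have := x_slow _ _ M0 Ms (ltW sT).
(* The delay 23 is the error 5 on the arrival time plus the duration of one edge, at most 18. *)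
have : v * (s - itinerary_length w k) <= 80^-1 * 23.
  by apply: ler_pM; rewrite ?(ltW v0) ?(ltW v1) ?subr_ge0 //; lra.
have := lam_lip l (x (itinerary_length w k)) (x s); rewrite enormB.
have := lam_lip l (x s) (y s); rewrite enormB.
have : enorm (y s - x s) < eps by [].
lra.
Qed.
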